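(* Let $(X,G)$ be a $G$-system with finite topological entropy, and let $\{F_n\}$ be a Følner sequence of $G$ such that $e_G\in F_1\subseteq F_2\subseteq\cdots$. If $(X,G)$ is asymptotically $h$-expansive, then it is D-hereditarily lowerable along $\{F_n\}$.
   Context: A $G$-system $(X,G)$ is a compact metric space $X$ with a countably infinite discrete amenable group $G$ (identity $e_G$) acting continuously on $X$ by homeomorphisms. A Følner sequence is a sequence $\{F_n\}$ of nonempty finite subsets of $G$ with $|F_n\triangle sF_n|/|F_n|\to0$ for every $s\in G$. For a finite cover $\mathcal U$ and finite $F\subseteq G$, $\mathcal U_F=\bigvee_{g\in F}g^{-1}\mathcal U$; $N(\mathcal U,K)$ is the minimal cardinality of a subfamily of $\mathcal U$ whose union contains $K$. The topological entropy is $h_{\mathrm{top}}(X,G)=\sup_{\mathcal U}\lim_n\frac1{|F_n|}\log N(\mathcal U_{F_n},X)$ over finite open covers $\mathcal U$ (independent of the Følner sequence). Tail entropy: for finite open covers $\mathcal U,\mathcal V$ of $X$, $N(\mathcal U|\mathcal V)=\sup_{V\in\mathcal V}N(\mathcal U,V)$, $h_{\mathrm{top}}(G,\mathcal U|\mathcal V)=\lim_n\frac1{|F_n|}\log N(\mathcal U_{F_n}|\mathcal V_{F_n})$ (independent of the Følner sequence), and $h^*_{\mathrm{top}}(X,G)=\inf_{\mathcal V}\sup_{\mathcal U}h_{\mathrm{top}}(G,\mathcal U|\mathcal V)$. $(X,G)$ is asymptotically $h$-expansive if $h^*_{\mathrm{top}}(X,G)=0$. Bowen topological entropy of $K\subseteq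 X$: for $\mathbb U=\{U_g\}_{g\in F_n}$ with $U_g\in\mathcal U$, put $m(\mathbb U)=|F_n|$ and $X(\mathbb U)=\bigcap_{g\in F_n}g^{-1}U_g$; let $\mathcal W_{F_n}(\mathcal U)$ be the set of all such $\mathbb U$. For $s\ge0$, $N\in\mathbb N$, let $\mathcal M(K,\mathcal U,N,s,\{F_n\})=\inf\sum_{\mathbb U\in\Lambda}e^{-s\,m(\mathbb U)}$, the infimum over all $\Lambda\subseteq\bigcup_{j\ge N}\mathcal W_{F_j}(\mathcal U)$ with $K\subseteq\bigcup_{\mathbb U\in\Lambda}X(\mathbb U)$; $\mathcal M(K,\mathcal U,s,\{F_n\})=\lim_{N\to\infty}\mathcal M(K,\mathcal U,N,s,\{F_n\})$. Then $h_{\mathrm{top}}^B(K,\mathcal U,\{F_n\})=\inf\{s:\mathcal M(K,\mathcal U,s,\{F_n\})=0\}$ and $h_{\mathrm{top}}^B(K,\{F_n\})=\sup_{\mathcal U}h_{\mathrm{top}}^B(K,\mathcal U,\{F_n\})$ over finite open covers $\mathcal U$. $(X,G)$ is D-hereditarily lowerable along $\{F_n\}$ if for every nonempty Souslin (i.e. analytic) set $K\subseteq X$ and every $0\le h\le h_{\mathrm{top}}^B(K,\{F_n\})$ there is a set $K_h\subseteq K$ with $h_{\mathrm{top}}^B(K_h,\{F_n\})=h$. *)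

(* Defs.v *)
From mathcomp Require Import all_boot all_order all_algebra finmap.
From mathcomp Require Import all_classical all_reals all_analysis.

Set Implicit Arguments.
Unset Strict Implicit.
Unset Printing Implicit Defensive.

Import Order.TTheory GRing.Theory Num.Theory.
Import numFieldNormedType.Exports.

Local Open Scope fset_scope.
Local Open Scope classical_set_scope.
Local Open Scope ring_scope.

(** Sequences [F_1, F_2, ...] are indexed from [0] throughout. *)

Definition lshift_fset (G : groupType) (s : G) (F : {fset G}) : {fset G} :=
  [fset (s * g)%g | g in F]%fset.

Definition symdiff_fset (G : groupType) (A B : {fset G}) : {fset G} :=
  ((A `\` B) `|` (B `\` A))%fset.

Definition folner_seq (R : realType) (G : groupType) (F : nat -> {fset G})
    : Prop :=
  (forall n, F n != fset0) /\
  (forall s : G,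
    (fun n => #|` symdiff_fset (F n) (lshift_fset s (F n))|%:R / #|` F n|%:R : R)
      @ \oo --> (0 : R)).

Definition amenable (R : realType) (G : groupType) : Prop :=
  exists F : nat -> {fset G}, folner_seq R F.

Record Gsystem (R : realType) (X : metricType R) (G : groupType)
    (act : G -> X -> X) : Prop := {
  gsys_compact : compact [set: X];
  gsys_countable : countable [set: G];
  gsys_infinite : infinite_set [set: G];
  gsys_amenable : amenable R G;
  gsys_act1 : forall x, act 1%g x = x;
  gsys_actM : forall g h x, act (g * h)%g x = act g (act h x);
  (* each [act g] is then a homeomorphism, with inverse [act g^-1] *)
  gsys_continuous : forall g, continuous (act g)
}.

Definition finite_open_cover (X : topologicalType) (U : set (set X)) : Prop :=
  [/\ finite_set U, (forall A, U A -> open A) &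
      \bigcup_(A in U) A = [set: X]].

(** A family of sets [{U_g}_{g in F}], packed with its finite index set [F]. *)
Definition set_family (X : Type) (G : groupType) : Type :=
  {F : {fset G} & {ffun F -> set X}}.

Definition fam_dom (X : Type) (G : groupType) (u : set_family X G) : {fset G} :=
  projT1 u.

Definition fam_fun (X : Type) (G : groupType) (u : set_family X G) :
  {ffun fam_dom u -> set X} := projT2 u.

Section Entropy.
Context (R : realType) (X : metricType R) (G : groupType) (act : G -> X -> X).
Implicit Types (U V : set (set X)) (K : set X) (F : {fset G}).
Implicit Types (u : set_family X G) (Fn : nat -> {fset G}).

(** [m(u) = |F|]. *)
Definition fam_card u : nat := #|` fam_dom u|.

(** [X(u)], the intersection of the [g^-1 U_g] for [g] in [F]. *)
Definition fam_set u : set X :=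
  \bigcap_(g in [set: fam_dom u]) (act (val g) @^-1` (fam_fun u g)).

(** [W_F(U)]. *)
Definition families U F : set (set_family X G) :=
  [set u | fam_dom u = F /\ forall g, U (fam_fun u g)].

(** The join [U_F] of the covers [g^-1 U] for [g] in [F]. *)
Definition cover_join U F : set (set X) := fam_set @` families U F.

(** [N(U, K)]; the minimum is attained as soon as some finite subfamily of [U]
    covers [K], and the value is [0] otherwise. *)
Definition cover_num U K : R :=
  inf [set #|` W|%:R | W in [set W : {fset set X} |
        [set` W] `<=` U /\ K `<=` \bigcup_(A in [set` W]) A]].

(** [N(U | V)]. *)
Definition cond_cover_num U V : R := sup [set cover_num U A | A in V].

Definition htop_cover Fn U : \bar R :=
  limn (fun n => (ln (cover_num (cover_join U (Fn n)) [set: X])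
                  / #|` Fn n|%:R)%:E).

Definition htop Fn : \bar R :=
  ereal_sup [set htop_cover Fn U | U in @finite_open_cover X].

Definition htop_cond Fn U V : \bar R :=
  limn (fun n =>
    (ln (cond_cover_num (cover_join U (Fn n)) (cover_join V (Fn n)))
     / #|` Fn n|%:R)%:E).

Definition tail_entropy Fn : \bar R :=
  ereal_inf [set ereal_sup [set htop_cond Fn U V | U in @finite_open_cover X]
            | V in @finite_open_cover X].

Definition asymptotically_h_expansive Fn : Prop := tail_entropy Fn = 0%E.

Definition bowen_premeasure K U (N : nat) (s : R) Fn : \bar R :=
  ereal_inf [set (\esum_(u in L) (expR (- s * (fam_card u)%:R))%:E)%E
            | L in [set L : set (set_family X G) |
                L `<=` \bigcup_(j in [set j | (N <= j)%N]) families U (Fn j) /\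
                K `<=` \bigcup_(u in L) fam_set u]].

Definition bowen_measure K U (s : R) Fn : \bar R :=
  limn (fun N => bowen_premeasure K U N s Fn).

Definition bowen_htop_cover K U Fn : \bar R :=
  ereal_inf [set s%:E | s in [set s : R | 0 <= s /\
                                          bowen_measure K U s Fn = 0%E]].

Definition bowen_htop K Fn : \bar R :=
  ereal_sup [set bowen_htop_cover K U Fn | U in @finite_open_cover X].

(** Souslin sets: the empty set and the continuous images of the Baire space. *)
Definition souslin K : Prop :=
  K = set0 \/
  exists f : prod_topology (fun _ : nat => nat) -> X,
    continuous f /\ range f = K.

Definition D_hereditarily_lowerable Fn : Prop :=
  forall K, K !=set0 -> souslin K ->
  forall h : \bar R, (0 <= h)%E -> (h <= bowen_htop K Fn)%E ->
  exists Kh : set X, Kh `<=` K /\ bowen_htop Kh Fn = h.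

End Entropy.

(* Main.v *)
Require Import Defs.
From mathcomp Require Import all_boot all_order all_algebra finmap.
From mathcomp Require Import all_classical all_reals all_analysis.
From mathcomp Require Import lra.

(** Asymptotic h-expansiveness gives a finite open cover [U] such that, for
    every finite open cover [W] and every large [n], each element of [U_{F_n}]
    is covered by at most [exp (e |F_n|)] elements of [W_{F_n}]; the
    Ornstein-Weiss lemma is needed here, as the tail entropy is defined by
    limits which might otherwise not exist. Let [V] be a double star refinement
    of [U]. Along levels [n_k] for which [|F_{n_k}|] grows geometrically, label
    each point with the first center close to it in a maximal
    [V_{F_{n_k}}]-separated finite set. The itinerary of labels defines nested
    finite Borel partitions; an element of [V_{F_{n_k}}] meets few cells of the
    [k]-th one, and such a cell is covered by few elements of [W_{F_{n_k}}], so
    that Bowen entropy is, up to a small error, the dimension of the tree of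
    cells.

    For tree dimensions no measures are needed. Parametrize the Souslin set by
    a closed subset [S] of the Baire space on which the labels are continuous.
    If [S] is not null at some exponent above [t], an increasing sets lemma
    modulo null sets gives a compact subset on which every cover by cells has
    [t]-weight at least [c], for some [c > 0]. By Zorn's lemma it contains a
    minimal compact set with this property. Minimality forces the part of it
    inside a cell [u] to be coverable by deeper cells of total weight arbitrarily
    close to at most that of [u]; hence it has dimension exactly [t].

    Subsets of entropy in [[h - eta, h]] for all [eta > 0], and the countable
    stability of Bowen entropy, give a subset of entropy [h]. *)

Set Implicit Arguments.
Unset Strict Implicit.
Unset Printing Implicit Defensive.

Import Order.TTheory GRing.Theory Num.Theory.
Import numFieldNormedType.Exports.

Local Open Scope classical_set_scope.
Local Open Scope ring_scope.

(** * Covers of small total weight *)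

Lemma esum_le_subset (R : realType) (J : choiceType) (A B : set J)
    (w : J -> \bar R) :
  A `<=` B -> (\esum_(j in A) w j <= \esum_(j in B) w j)%E.
Proof.
move=> AB; apply: le_ereal_sup => _ [Y [finY YA] <-].
by exists Y => //; split => // t /YA /AB.
Qed.

(** The sets [A i] may overlap: choosing one index for each element embeds their union into the
    disjoint union, over which the double sum runs. *)
Lemma esum_bigcup_le (R : realType) (I J : choiceType) (D : set I)
    (A : I -> set J) (w : J -> \bar R) (v : I -> \bar R) :
  (forall j, 0 <= w j)%E ->
  (forall i, D i -> \esum_(j in A i) w j <= v i)%E ->
  (\esum_(j in \bigcup_(i in D) A i) w j <= \esum_(i in D) v i)%E.
Proof.
move=> w0 Av; apply: (@le_trans _ _ (\esum_(i in D) \esum_(j in A i) w j)%E);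
  last exact: le_esum.
have [->|/set0P[j0 [i0 _ _]]] := eqVneq (\bigcup_(i in D) A i) set0.
  by rewrite esum_set0; apply: esum_ge0 => i _; exact: esum_ge0.
have /choice[e eP] : forall j, exists i,
    (\bigcup_(i in D) A i) j -> D i /\ A i j.
  move=> j; have [[i Di Aij]|nj] := pselect ((\bigcup_(i in D) A i) j).
    by exists i.
  by exists i0.
rewrite (@esum_esum _ _ _ D A (fun=> w))//.
rewrite (_ : \esum_(j in \bigcup_(i in D) A i) w j =
  \esum_(j in (fun j => (e j, j)) @` (\bigcup_(i in D) A i)) w j.2)%E; last first.
  by rewrite esum_image// => x y _ _ [].
by apply: esum_le_subset => -[i j] [j' /eP[De Ae]] [<- <-]; split.
Qed.

Lemma esum_setU_le (R : realType) (J : choiceType) (A B : set J)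
    (w : J -> \bar R) : (forall j, 0 <= w j)%E ->
  (\esum_(j in A `|` B) w j <= \esum_(j in A) w j + \esum_(j in B) w j)%E.
Proof.
move=> w0; rewrite (esumID A)//; apply: leeD; apply: esum_le_subset.
  by move=> x [].
by move=> x [[]].
Qed.

Section Covered.
Context (R : realType) (J : choiceType) (X : Type).
Context (D : set J) (sh : J -> set X) (w : J -> R).
Hypothesis w0 : forall j, 0 <= w j.

(** Stated for abstract indices, this serves both for cells of nested partitions and for the
    families of Bowen's definition; [D] allows covers to be confined to late levels. *)
Definition covered (c : R) (E : set X) : Prop :=
  exists L, [/\ L `<=` D, E `<=` \bigcup_(j in L) sh j &
                (\esum_(j in L) (w j)%:E <= c%:E)%E].

Definition null (E : set X) : Prop := forall c, 0 < c -> covered c E.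

Lemma sub_covered c c' E E' :
  E `<=` E' -> c' <= c -> covered c' E' -> covered c E.
Proof.
move=> EE' cc' [L [LD E'L Lc]]; exists L; split => //.
  exact: subset_trans E'L.
by apply: le_trans Lc _; rewrite lee_fin.
Qed.

Lemma sub_null E E' : E `<=` E' -> null E' -> null E.
Proof. by move=> EE' nE' c /nE'; exact: sub_covered. Qed.

Lemma coveredU c c' E E' :
  covered c E -> covered c' E' -> covered (c + c') (E `|` E').
Proof.
move=> [L [LD EL Lc]] [L' [LD' EL' Lc']]; exists (L `|` L'); split.
- by move=> j [/LD|/LD'].
- by move=> x [/EL|/EL'] [j Lj shj]; exists j => //; [left|right].
- rewrite EFinD; apply: le_trans (leeD Lc Lc').
  by apply: esum_setU_le => j; rewrite lee_fin.
Qed.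

Lemma null_bigcup (E : nat -> set X) :
  (forall m, null (E m)) -> null (\bigcup_m E m).
Proof.
move=> nE c c0.
have /choice[L LP] : forall m, exists L, [/\ L `<=` D,
    E m `<=` \bigcup_(j in L) sh j &
    (\esum_(j in L) (w j)%:E <= 0 + (c / (2 ^ m.+1)%:R)%:E)%E].
  move=> m; rewrite add0e; apply: nE.
  by rewrite divr_gt0// ltr0n expn_gt0.
exists (\bigcup_m L m); split.
- by move=> j [m _ Lmj]; have [+ _ _] := LP m; exact.
- by move=> x [m _ /(let: And3 _ h _ := LP m in h _)[j ? ?]]; exists j => //; exists m.
- apply: (@le_trans _ _ (\esum_(m in setT) (0 + (c / (2 ^ m.+1)%:R)%:E)%E)).
    apply: esum_bigcup_le => [j|m _]; first by rewrite lee_fin.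
    by have [] := LP m.
  rewrite -nneseries_esumT; last first.
    by move=> n; rewrite add0e lee_fin divr_ge0// ltW.
  apply: le_trans (epsilon_trick xpredT _ (ltW c0)) _ => //.
  by rewrite eseries0// add0e.
Qed.

End Covered.

Lemma esum_scale_le (R : realType) (J : choiceType) (L : set J) (w w' : J -> R)
    (r c : R) : 0 <= r -> (forall j, L j -> w' j <= r * w j) ->
  (\esum_(j in L) (w j)%:E <= c%:E)%E ->
  (\esum_(j in L) (w' j)%:E <= (r * c)%:E)%E.
Proof.
move=> r0 w'w Lc; apply: ge_ereal_sup => _ [Y [finY YL] <-].
rewrite fsumEFin//.
have : (\sum_(j \in Y) (w j)%:E <= c%:E)%E.
  by apply: le_trans Lc; apply: ereal_sup_ubound; exists Y.
rewrite fsumEFin// !lee_fin => Yc; apply: le_trans (ler_wpM2l r0 Yc).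
rewrite !fsbig_finite//= mulr_sumr big_seq [leRHS]big_seq.
by apply: ler_sum => j; rewrite in_fset_set// inE => /YL; exact: w'w.
Qed.

Lemma esum_sum_disjoint_le (R : realType) (I J : choiceType) (Y : {fset I})
    (L : set J) (A : I -> set J) (w : J -> \bar R) :
  (forall j, 0 <= w j)%E ->
  (forall i, i \in Y -> A i `<=` L) ->
  (forall i i' j, i \in Y -> i' \in Y -> A i j -> A i' j -> i = i') ->
  (\sum_(i <- Y) \esum_(j in A i) w j <= \esum_(j in L) w j)%E.
Proof.
move=> w0 AL Adisj.
have AE i : i \in Y ->
    (\esum_(j in A i) w j = \esum_(j in L) if j \in A i then w j else 0)%E.
  by move=> iY; rewrite -esum_mkcondr (setIidr (AL _ iY)).
rewrite big_seq (eq_bigr _ AE) -big_seq -esum_sum; last first.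
  by move=> j i _ _; case: ifP.
apply: le_esum => j Lj.
have [[i /andP[iY /set_mem Aij]]|nY] :=
  pselect (exists i, (i \in Y) && (j \in A i)).
  rewrite (bigD1_seq i)//= mem_set// big1_seq ?adde0//= => i' /andP[i'i i'Y].
  case: ifPn => // /set_mem Ai'j.
  by rewrite (Adisj _ _ _ iY i'Y Aij Ai'j) eqxx in i'i.
rewrite big1_seq// => i /andP[_ iY]; case: ifPn => // Aij.
by exfalso; apply: nY; exists i; rewrite iY.
Qed.

Lemma esum_seq_le (R : realType) (J : choiceType) (A : set J) (r : seq J)
    (w : J -> R) (c : R) : 0 <= c -> (forall j, A j -> j \in r) ->
  (forall j, A j -> w j <= c) ->
  (\esum_(j in A) (w j)%:E <= ((size r)%:R * c)%:E)%E.
Proof.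
move=> c0 Ar wc; apply: ge_ereal_sup => _ [Y [finY YA] <-].
rewrite fsumEFin// lee_fin fsbig_finite//=.
apply: (@le_trans _ _ (\sum_(j <- fset_set Y) c)).
  rewrite big_seq [leRHS]big_seq; apply: ler_sum => j.
  by rewrite in_fset_set// inE => /YA /wc.
rewrite big_const_seq count_predT iter_addr_0 -[leLHS]mulr_natl.
apply: ler_wpM2r => //; rewrite ler_nat uniq_leq_size// => j.
by rewrite in_fset_set// inE => /YA /Ar.
Qed.

(** * Dimension of nested partitions *)

Section Net.
Context (R : realType) (S : Type) (T : choiceType).
Context (q : nat -> S -> T) (a : nat -> R).
Hypothesis q_refine : forall k x y, q k.+1 x = q k.+1 y -> q k x = q k y.
Hypothesis a_homo : {homo a : m n / (m <= n)%N >-> m <= n}.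
Hypothesis a_unbounded : forall C, exists k, C < a k.

Definition cell (u : nat * T) : set S := [set x | q u.1 x = u.2].

(** Here [a k] plays the role of the number of time steps seen at level [k], so this is the analogue
    of the weight $e^{-s m(u)}$ in Bowen entropy. *)
Definition weight (t : R) (u : nat * T) : R := expR (- t * a u.1).

Lemma weight_ge0 t u : 0 <= weight t u. Proof. exact: expR_ge0. Qed.

Lemma weight_gt0 t u : 0 < weight t u. Proof. exact: expR_gt0. Qed.

Hint Resolve weight_ge0 weight_gt0 : core.

Definition ncovered t c E := covered setT cell (weight t) c E.

(** No depth is imposed on the covers: for a positive exponent, a cell of small weight is
    automatically deep. *)
Definition nnull t E := null setT cell (weight t) E.

Lemma q_refine_le j k x y : (j <= k)%N -> q k x = q k y -> q j x = q j y.
Proof.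
move=> /subnK <-; elim: (k - j)%N => [//|n IH]; rewrite addSn.
by move=> /q_refine.
Qed.

Lemma weight_exponent t s u : weight s u = expR (- (s - t) * a u.1) * weight t u.
Proof. by rewrite /weight -expRD -mulrDl opprB addrAC subrr add0r. Qed.

Lemma weight_small t c : 0 < t -> 0 < c -> exists k, expR (- t * a k) <= c.
Proof.
move=> t0 c0; have [k ck] := a_unbounded (- ln c / t); exists k.
rewrite -ler_ln ?posrE ?expR_gt0// expRK mulNr lerNl.
by move: ck => /ltW; rewrite ler_pdivrMr// mulrC.
Qed.

(** Raising the exponent from [t] to [s] multiplies the weight of a cell of level at least [L] by at
    most $e^{-(s-t)a_L}$, which is arbitrarily small. *)
Lemma nnull_deep s t c E : t < s ->
  (forall L, covered [set u | (L <= u.1)%N] cell (weight t) c E) ->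
  nnull s E.
Proof.
move=> ts cE e e0.
have c0 : 0 <= c.
  have [B [_ _]] := cE 0; rewrite -lee_fin; apply: le_trans.
  by apply: esum_ge0 => j _; rewrite lee_fin.
have [L Lsmall] : exists L, expR (- (s - t) * a L) <= e / (c + 1).
  by apply: weight_small; rewrite ?subr_gt0// divr_gt0// ltr_wpDl.
have [B [BL EB Bc]] := cE L; exists B; split=> //.
apply: (@le_trans _ _ (e / (c + 1) * c)%:E); last first.
  rewrite lee_fin mulrAC ler_pdivrMr ?ltr_wpDl// ler_pM2l//.
  by rewrite lerDl.
apply: esum_scale_le Bc; first by apply: divr_ge0; [exact: ltW|exact: addr_ge0].
move=> u /BL /= Lu; rewrite (weight_exponent t) ler_wpM2r//.
apply: le_trans Lsmall; rewrite ler_expR !mulNr lerN2.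
by apply: ler_wpM2l; [rewrite subr_ge0 ltW|exact: a_homo].
Qed.

(** The exceptional set, null at a larger exponent, absorbs the points that lie in no saturated cell
    in the next lemma. *)
Definition almost_covered t t' c E :=
  exists2 Z, nnull t' Z & ncovered t c (E `\` Z).

(* Increasing sets lemma, modulo null sets of a larger exponent. A node is
   saturated when the limit of the premeasures of the [E i] inside it reaches
   its weight; covers can be refined until no shallow unsaturated node is left,
   and the shallowest saturated nodes cover all but a null set. *)
Lemma almost_covered_bigcup (t t' c : R) (E : nat -> set S) : 0 < t -> t < t' ->
  {homo E : i j / (i <= j)%N >-> i `<=` j} ->
  (forall i, almost_covered t t' c (E i)) ->
  almost_covered t t' c (\bigcup_i E i).
Proof.
move=> t0 tt' homoE cE.
have /choice[Z0 Z0P] : forall i, exists Z, nnull t' Z /\ ncovered t c (E i `\` Z).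
  by move=> i; have [Z] := cE i; exists Z.
pose Z := \bigcup_i Z0 i.
have nZ : nnull t' Z.
  by apply: null_bigcup => [u|i]; [exact: weight_ge0|have [] := Z0P i].
pose E' i := E i `\` Z.
have homoE' i j : (i <= j)%N -> E' i `<=` E' j.
  by move=> /homoE ij x [/ij].
have cE' i : ncovered t c (E' i).
  have [_] := Z0P i; apply: sub_covered => // x [Ex nZx]; split=> // Zx.
  by apply: nZx; exists i.
pose sat u := forall d, d < weight t u -> exists i, ~ ncovered t d (E' i `&` cell u).
(* Induction on [L]: an unsaturated cell of level [L] is replaced by a cover of strictly smaller
   total weight. Each cell of that cover is lighter than the one replaced, hence deeper since [a] is
   nondecreasing. *)
have refine i L : exists B, [/\ E' i `<=` \bigcup_(u in B) cell u,
    (\esum_(u in B) (weight t u)%:E <= c%:E)%E &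
    forall u, B u -> (u.1 < L)%N -> sat u].
  elim: L => [|L [B [EB Bc Bsat]]].
    by have [B [_ ? ?]] := cE' i; exists B; split.
  have /choice[r rP] : forall u, exists D : set (nat * T),
      [/\ E' i `&` cell u `<=` \bigcup_(v in D) cell v,
          (\esum_(v in D) (weight t v)%:E <= (weight t u)%:E)%E &
          B u -> forall v, D v -> (v.1 < L.+1)%N -> sat v].
    move=> u; have [[usat|Lu]|nu] := pselect (sat u \/ (L < u.1)%N).
    - exists [set u]; split=> [x [_ ux]||_ v -> _//]; first by exists u.
      by rewrite esum_set1 ?lee_fin.
    - exists [set u]; split=> [x [_ ux]||_ v ->]; first by exists u.
        by rewrite esum_set1 ?lee_fin.
      by rewrite ltnS leqNgt Lu.
    have /not_orP[nsatu /negP] := nu; rewrite -leqNgt => uL.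
    have [d] : exists d, ~ (d < weight t u ->
        exists i, ~ ncovered t d (E' i `&` cell u)) by exact/existsNP.
    move=> /not_implyP[du /forallNP/(_ i)/contrapT[D [_ cD Dd]]].
    have Dlt v : D v -> weight t v < weight t u.
      move=> Dv; apply: le_lt_trans du; rewrite -lee_fin.
      apply: le_trans Dd; rewrite -[leLHS](@esum_set1 R _ v (fun v => (weight t v)%:E)) ?lee_fin//.
      by apply: esum_le_subset => _ ->.
    exists D; split => //.
      by apply: le_trans Dd _; rewrite lee_fin ltW.
    move=> Bu v Dv; rewrite ltnS => vL.
    have [ueqL|uneqL] := eqVneq u.1 L; last first.
      by have := Bsat u Bu; rewrite ltn_neqAle uneqL uL => /(_ isT).
    have := Dlt v Dv; rewrite /weight ltr_expR !mulNr ltrN2 ltr_pM2l// ltNge.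
    by rewrite ueqL a_homo.
  have [r' r'P] : exists r' : nat * T -> set (nat * T), forall u, B u ->
      [/\ E' i `&` cell u `<=` \bigcup_(v in r' u) cell v,
          (\esum_(v in r' u) (weight t v)%:E <= (weight t u)%:E)%E &
          forall v, r' u v -> (v.1 < L.+1)%N -> sat v].
    by exists r => u Bu; have [? ? /(_ Bu)] := rP u.
  exists (\bigcup_(u in B) r' u); split.
  - move=> x Ex; have [u Bu xu] := EB _ Ex.
    have [/(_ _ (conj Ex xu))[v rv xv] _ _] := r'P u Bu.
    by exists v => //; exists u.
  - apply: le_trans Bc; apply: esum_bigcup_le => [v|u Bu]; first by rewrite lee_fin.
    by have [] := r'P u Bu.
  - by move=> v [u Bu rv]; have [_ _] := r'P u Bu; exact.
(* A cover refined up to level [L] can reach these points only through cells of level at least [L],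
   so [nnull_deep] applies. *)
pose N := \bigcup_i (E' i `&` [set x | forall k, ~ sat (k, q k x)]).
have nN : nnull t' N.
  apply: null_bigcup => [u|i]; first exact: weight_ge0.
  apply: (@nnull_deep t' t c) => // L; have [B [EB Bc Bsat]] := refine i L.
  exists (B `&` [set u | (L <= u.1)%N]); split.
  - by move=> u [].
  - move=> x [Ex nsat]; have [[k l] Bu /= xl] := EB _ Ex.
    exists (k, l) => //; split => //=; rewrite leqNgt; apply/negP => kL.
    by apply: (nsat k); rewrite xl; exact: Bsat.
  - by apply: le_trans Bc; apply: esum_le_subset => u [].
exists (Z `|` N).
  apply: (@sub_null _ _ _ _ _ _ _ (\bigcup_i (if i is 0 then Z else N))).
    by move=> x [?|?]; [exists 0|exists 1].
  by apply: null_bigcup => [u|[|i]]; first exact: weight_ge0.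
pose A := [set u | sat u /\ forall x j, cell u x -> (j < u.1)%N -> ~ sat (j, q j x)].
have satE u d i0 : sat u -> d < weight t u ->
  exists2 i, (i0 <= i)%N & ~ ncovered t d (E' i `&` cell u).
  move=> usat /usat[i ci]; exists (maxn i0 i); first exact: leq_maxl.
  apply: contra_not ci; apply: sub_covered => //; apply: setSI.
  exact/homoE'/leq_maxr.
exists A; split=> //.
  move=> x [[i _ Ex] /not_orP[nZx nNx]].
  have [k ksat] : exists k, sat (k, q k x).
    apply: contrapT => /forallNP nsat; apply: nNx; exists i => //.
  have exk : exists k, `[< sat (k, q k x) >] by exists k; apply/asboolP.
  case: (ex_minnP exk) => m /asboolP msat mmin.
  exists (m, q m x) => //; split=> // y j /= yx jm.
  rewrite (q_refine_le (ltnW jm) yx) => /asboolP jsat.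
  by have := mmin _ jsat; rewrite leqNgt jm.
apply: ge_ereal_sup => _ [Y [finY YA] <-].
have c0 : 0 <= c.
  have [B [_ _]] := cE' 0; rewrite -lee_fin; apply: le_trans.
  by apply: esum_ge0 => j _; rewrite lee_fin.
rewrite fsbig_finite//=.
(* Saturation recovers the weight of a cell only up to a factor [r < 1]; finitely many cells then
   share one index [i]. *)
apply/lee_mul01Pr => [|r /andP[r0 r1]]; first by apply: sume_ge0 => u _; rewrite lee_fin.
have [i iP] : exists i, forall u, Y u -> ~ ncovered t (r * weight t u) (E' i `&` cell u).
  suff [i iP] : exists i, forall u, u \in fset_set Y ->
      ~ ncovered t (r * weight t u) (E' i `&` cell u).
    by exists i => u Yu; apply: iP; rewrite in_fset_set// inE.
  have rY u : u \in fset_set Y -> sat u /\ r * weight t u < weight t u.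
    rewrite in_fset_set// inE => /YA[usat _]; split=> //.
    by rewrite gtr_pMl ?weight_gt0.
  suff H (s : seq (nat * T)) : {subset s <= fset_set Y} -> exists i, forall u, u \in s ->
      ~ ncovered t (r * weight t u) (E' i `&` cell u).
    by have [i iP] := H (enum_fset (fset_set Y)) (fun u => id); exists i.
  elim: s => [|u s IH] sY.
    by exists 0%N => u; rewrite in_nil.
  have [v vs|i0 i0P] := IH _; first by apply: sY; rewrite inE vs orbT.
  have [usat ur] := rY u (sY u (mem_head _ _)).
  have [i i0i iP] := satE _ _ i0 usat ur.
  exists i => v; rewrite inE => /orP[/eqP->//|vs].
  apply: contra_not (i0P v vs); apply: sub_covered => //; apply: setSI.
  exact: homoE'.
pose L := (\max_(u <- fset_set Y) u.1).+1.
have [B [EB Bc Bsat]] := refine i L.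
apply: le_trans Bc.
rewrite ge0_sume_distrr//.
(* A cell of [B] strictly above [u] would be saturated, as [B] is refined past all levels of [Y];
   this contradicts the choice of [u] as shallowest. So [below u] covers the part of [E' i] in [u].
   These families are disjoint because the cells of [Y] are. *)
pose below u := B `&` [set v | (u.1 <= v.1)%N /\ exists2 x, cell u x & cell v x].
apply: le_trans (@esum_sum_disjoint_le _ _ _ (fset_set Y) B below _ _ _ _) => //.
- rewrite big_seq [leRHS]big_seq; apply: lee_sum => u; rewrite in_fset_set// inE => Yu.
  rewrite leNgt; apply/negP => lt; apply: (iP u Yu).
  exists (below u); split=> //; last by rewrite EFinM ltW.
  move=> x [Ex ux]; have [v Bv vx] := EB _ Ex.
  exists v => //; split=> //; split; last by exists x.
  rewrite leqNgt; apply/negP => vu.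
  have [_ /(_ x v.1 ux vu)] := YA _ Yu; apply.
  rewrite (_ : (v.1, _) = v); last by rewrite vx; case: (v).
  apply: Bsat => //; rewrite ltnS; apply: leq_trans (ltnW vu) _.
  by apply: (@leq_bigmax_seq _ _ xpredT fst u) => //; rewrite in_fset_set// inE.
- by move=> v; rewrite lee_fin.
- by move=> u _ v [].
- move=> u u' v; rewrite !in_fset_set// !inE => Yu Yu'.
  wlog uu' : u u' Yu Yu' / (u.1 <= u'.1)%N.
    move=> H bu bu'; have [|/ltnW] := leqP u.1 u'.1; first by move/H; exact.
    by move=> h; apply/esym/H.
  move=> [_ [uv [x ux vx]]] [_ [u'v [y u'y vy]]].
  have uy : cell u y.
    rewrite /cell/= -ux; apply: (q_refine_le uv).
    by rewrite vy vx.
  have [lt|] := ltnP u.1 u'.1.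
    have [_ /(_ y u.1 u'y lt)[]] := YA _ Yu'.
    rewrite uy; have [] := YA _ Yu; by case: (u).
  move=> le; have eq1 : u.1 = u'.1 by apply/eqP; rewrite eqn_leq uu'.
  move: uy u'y; rewrite /cell/= eq1 => uy u'y; move: eq1 uy.
  by case: (u) (u') u'y => [? ?] [? ?] /= <- -> <-.
by move=> u _; rewrite lee_fin.
Qed.

End Net.

(** * Compactness in the Baire space *)

Lemma compact_finite_cover (T : topologicalType) (K : set T) (I : choiceType)
    (D : set I) (f : I -> set T) :
  compact K -> (forall i, D i -> open (f i)) -> K `<=` \bigcup_(i in D) f i ->
  exists s : seq I, (forall i, i \in s -> D i) /\ K `<=` \bigcup_(i in [set` s]) f i.
Proof.
move=> /compact_near_coveringP Kcov fop Kf.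
(* The filter of finite lists of indices directed by inclusion, to which the near-covering form of
   compactness is applied. *)
pose F : set_system (seq I) := filter_from [set s : seq I | forall i, i \in s -> D i]
  (fun s : seq I => [set s' | (forall i, i \in s' -> D i) /\ {subset s <= s'}]).
have FF : ProperFilter F.
  apply: filter_from_proper; last by move=> s sD; exists s; split=> // i.
  apply: filter_from_filter; first by exists [::].
  move=> s s' sD s'D; exists (s ++ s') => /=.
    by move=> i; rewrite mem_cat => /orP[/sD|/s'D].
  move=> s'' [s''D ss'']; split; split=> // i ii; apply: ss'';
    by rewrite mem_cat ii ?orbT.
have [|s sD sP] := Kcov (seq I) F (fun s x => exists2 i, i \in s & f i x) _.
  move=> x /Kf[i Di fix_]; exists (f i, [set s | (forall i, i \in s -> D i) /\ i \in s]).
    split=> /=; first by apply: open_nbhs_nbhs; split=> //; exact: fop.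
    exists [:: i] => /=; first by move=> j; rewrite inE => /eqP->.
    by move=> s [sD is_]; split => //; apply: is_; rewrite inE.
  by move=> [y s] /= [fiy [_ is_]]; exists i.
by exists s; split => // x /(sP s (conj sD (fun=> id)))[i is_ fx]; exists i.
Qed.

Notation baire := (prod_topology (fun _ : nat => nat)).

Lemma baire_proj_continuous i : continuous (fun s : baire => s i).
Proof. exact: (@proj_continuous nat (fun=> nat) i). Qed.

Lemma baire_box_compact (y : nat -> nat) :
  compact ([set s | forall i, (s i <= y i)%N] : set baire).
Proof.
apply: (@tychonoff nat (fun=> nat) (fun i => [set n | (n <= y i)%N])) => i.
by apply: finite_compact; apply: (sub_finite_set _ (finite_II (y i).+1)).
Qed.

Lemma baire_slice_closed i n : closed ([set s | (s i <= n)%N] : set baire).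
Proof.
apply: (@closed_comp baire nat (fun s => s i) [set m | (m <= n)%N]).
  by move=> s _; exact: baire_proj_continuous.
exact: discrete_closed.
Qed.

(** * Subsets of prescribed dimension *)

Section NetBaire.
Context (R : realType) (T : choiceType).
Context (q : nat -> baire -> T) (a : nat -> R).
Hypothesis q_refine : forall k x y, q k.+1 x = q k.+1 y -> q k x = q k y.
Hypothesis q_open : forall k l, open [set s | q k s = l].
Hypothesis a_ge0 : forall k, 0 <= a k.
Hypothesis a_homo : {homo a : m n / (m <= n)%N >-> m <= n}.
Hypothesis a_unbounded : forall C, exists k, C < a k.

Let ncovered := ncovered q a.
Let nnull := nnull q a.
Let cell := cell q.
Let weight := weight (T := T) a.

Let weight_ge0 t u : 0 <= weight t u. Proof. exact: weight_ge0. Qed.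

(** Only the first [k] coordinates are bounded: for closed [S] these sets are closed, and they
    decrease to the compact set [fullbox S y]. *)
Let box (S : set baire) (y : nat -> nat) (k : nat) : set baire :=
  [set s | S s /\ forall i, (i < k)%N -> (s i <= y i)%N].

Let fullbox (S : set baire) (y : nat -> nat) : set baire :=
  [set s | S s /\ forall i, (s i <= y i)%N].

Let box_closed S y k : closed S -> closed (box S y k).
Proof.
move=> cS; have -> : box S y k = S `&` \bigcap_(i in [set i | (i < k)%N])
    [set s | (s i <= y i)%N].
  by apply/seteqP; split=> s [].
apply: closedI => //; apply: closed_bigI => i _; exact: baire_slice_closed.
Qed.

Let fullbox_compact S y : closed S -> compact (fullbox S y).
Proof.
move=> cS; apply: (subclosed_compact _ (@baire_box_compact y)); last by move=> s [].
have -> : fullbox S y = S `&` \bigcap_i [set s | (s i <= y i)%N].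
  by apply/seteqP; split=> s [sS sy]; split=> // i; [move=> _; exact: sy|exact: sy].
apply: closedI => //; apply: closed_bigI => i _; exact: baire_slice_closed.
Qed.

(** The bounds are chosen one coordinate at a time. As the next bound grows, the boxes increase to
    the current one, so by the increasing sets lemma some finite bound keeps the box from being
    almost covered. *)
Let exists_box (t t' c : R) S : 0 < t -> t < t' ->
  ~ almost_covered q a t t' c S ->
  exists y, forall k, ~ almost_covered q a t t' c (box S y k).
Proof.
move=> t0 tt' nS.
pose E (l : seq nat) := [set s : baire | S s /\
  forall i, (i < size l)%N -> (s i <= nth 0 l i)%N].
have /choice[next nextP] : forall l, exists n, ~ almost_covered q a t t' c (E l) ->
    ~ almost_covered q a t t' c (E (rcons l n)).
  move=> l; have [al|nal] := pselect (almost_covered q a t t' c (E l)).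
    by exists 0%N.
  apply: contrapT => /forallNP H; apply: nal.
  have -> : E l = \bigcup_n E (rcons l n).
    apply/seteqP; split=> [s [sS sl]|s [n _ [sS sl]]].
      exists (s (size l)) => //; split=> // i; rewrite size_rcons ltnS nth_rcons.
      by rewrite leq_eqVlt => /orP[/eqP->|il]; rewrite ?ltnn ?eqxx// il sl.
    split=> // i il; have := sl i; rewrite size_rcons nth_rcons il; apply.
    exact: ltnW.
  apply: almost_covered_bigcup => //.
    move=> m n mn s [sS sl]; split=> // i il.
    have := sl i; rewrite !size_rcons !nth_rcons in il * => /(_ il).
    case: ifP => // _; case: ifP => // _ h; exact: leq_trans mn.
  by move=> n; have /not_implyP[_ /contrapT] := H n.
pose ls := fix ls k := if k is k'.+1 then rcons (ls k') (next (ls k')) else [::].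
pose y k := next (ls k).
have lsE k : ls k = mkseq y k by elim: k => [//|k IH]; rewrite mkseqS -IH.
exists y => k.
have -> : box S y k = E (ls k).
  apply/seteqP; split=> s [sS sl]; split=> // i.
    by rewrite lsE size_mkseq => ik; rewrite nth_mkseq// sl.
  by move=> ik; have := sl i; rewrite lsE size_mkseq nth_mkseq//; exact.
elim: k => [|k IH]; last exact: nextP.
by apply: contra_not nS => -[Z nZ cZ]; exists Z => //; apply: sub_covered cZ => //; apply: setSD.
Qed.

(** Otherwise points [x k] of the boxes outside [O] would have a cluster point in [fullbox S y]
    outside [O]. They lie in a common compact box: at coordinate [i] only the points with [k <= i]
    may exceed [y i], and [z i] adds their values. *)
Let fullbox_sub_open S y (O : set baire) : closed S -> open O ->
  fullbox S y `<=` O -> exists k, box S y k `<=` O.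
Proof.
move=> cS oO yO; apply: contrapT => /forallNP nO.
have /choice[x xP] : forall k, exists x, box S y k x /\ ~ O x.
  by move=> k; have /existsNP[x /not_implyP[? ?]] := nO k; exists x.
pose z i := (y i + \sum_(k < i.+1) x k i)%N.
have xz k i : (x k i <= z i)%N.
  have [ki|ik] := ltnP i k.
    by apply: leq_trans (leq_addr _ _); have [[_ +] _] := xP k; exact.
  apply: leq_trans (leq_addl _ _).
  by rewrite (bigD1 (Ordinal (ik : (k < i.+1)%N)))//= leq_addr.
have xF : (x @ \oo) [set s : baire | forall i, (s i <= z i)%N].
  by exists 0%N => // n _ i; exact: xz.
have [p [_ px]] := @baire_box_compact z (x @ \oo) _ xF.
have pbox k : (box S y k `&` ~` O) p.
  have cl : closed (box S y k `&` ~` O).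
    by apply: closedI; [exact: box_closed|exact: open_closedC].
  apply: cl => B pB; apply: px => //.
  exists k => // n /= kn; have [[sS sy] nOx] := xP n; split=> //; split=> // i ik.
  by apply: sy; exact: leq_trans kn.
have [_] := pbox 0; apply; apply: yO; split; first by have [[]] := pbox 0.
by move=> i; have [[_ +] _] := pbox i.+1; apply.
Qed.

Let cells_open B : open (\bigcup_(u in B) cell u).
Proof. by apply: bigcup_open => -[k l] _; exact: q_open. Qed.
Lemma net_subset (t t' : R) (S : set baire) : closed S -> 0 < t -> t < t' ->
  ~ nnull t' S ->
  exists C, [/\ C `<=` S, forall s, t < s -> nnull s C & ~ nnull t C].
Proof.
move=> cS t0 tt' nS.
(* Weights decrease with the exponent, so a set almost covered at every positive weight is null at
   [t']. *)
have [c c0 cP] : exists2 c, 0 < c & ~ almost_covered q a t t' c S.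
  apply: contrapT => /forall2NP H; apply: nS => e e0.
  have e20 : 0 < e / 2 by rewrite divr_gt0.
  have [//|/contrapT[Z nZ [L [_ LZ Le]]]] := H (e / 2).
  rewrite [e]splitr; apply: (@sub_covered _ _ _ _ _ _ _ _ _ (Z `|` (S `\` Z))).
  - by move=> s Ss; have [?|?] := pselect (Z s); [left|right].
  - exact: lexx.
  apply: coveredU; [exact: weight_ge0|exact: nZ|].
  exists L; split=> //; apply: le_trans Le; apply: le_esum => u _.
  by rewrite lee_fin ler_expR !mulNr lerN2 ler_wpM2r// ltW.
have [y yP] := exists_box t0 tt' cP.
pose K := fullbox S y.
have K_compact : compact K by exact: fullbox_compact.
have ncK : ~ ncovered t c K.
  move=> [L [_ KL Lc]].
  (* Cells are open, so a cover of the compact [K] already covers some box, against the choice of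
     [y]. *)
  have [k kL] := fullbox_sub_open cS (cells_open L) KL.
  apply: (yP k); exists set0; last first.
    by exists L; split=> // s [/kL].
  move=> e e0; exists set0; split=> //.
  by rewrite esum_set0 lee_fin ltW.
(* Zorn's lemma is applied to the open complements: a maximal [W] leaves a minimal compact set that
   cannot be covered at weight [c]. *)
pose P := [set W : set baire | open W /\ ~ ncovered t c (K `\` W)].
have [F FP totF|W [[oW ncW] Wmax]] := @Zorn_bigcup _ P.
  split; first by apply: bigcup_open => W /FP[].
  move=> [L [_ KL Lc]].
  have [F0|/set0P[W0 FW0]] := eqVneq F set0.
    by apply: ncK; exists L; split=> // s Ks; apply: KL; rewrite F0 bigcup_set0; split.
  (* By compactness, cells covering what the union of the chain leaves of [K] already cover what its
     largest member among finitely many leaves. *)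
  have [| |s [sF Ks]] := @compact_finite_cover _ K _ F
      (fun W => W `|` \bigcup_(u in L) cell u) K_compact.
  - by move=> W /FP[oW _]; apply: openU => //; exact: cells_open.
  - move=> x Kx; have [[W FW Wx]|nx] := pselect ((\bigcup_(X in F) X) x).
      by exists W => //; left.
    by exists W0 => //; right; exact: KL.
  have [W FW sW] : exists2 W, F W & forall W', W' \in s -> W' `<=` W.
    elim: s sF {Ks} => [|W s IH] sF; first by exists W0.
    have [|W1 FW1 sW1] := IH; first by move=> W' W's; apply: sF; rewrite inE W's orbT.
    have [WW1|W1W] := totF _ _ (sF W (mem_head _ _)) FW1.
      by exists W1 => // W'; rewrite inE => /orP[/eqP->//|/sW1].
    exists W; first exact/sF/mem_head.
    by move=> W'; rewrite inE => /orP[/eqP->//|/sW1]; move/subset_trans; apply.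
  have [_] := FP _ FW; apply; exists L; split=> // x [Kx nWx].
  by have [W' /= /sW W'W [/W'W//|]] := Ks _ Kx.
pose C := K `\` W.
(* Otherwise, a deep cell inside [u] could be removed from [C]: a cheaper cover
   of the rest would have to use [u] or a cell above it, hence cover [C]. *)
have local_cover u r : 1 < r ->
    covered [set v | (u.1 < v.1)%N] cell (weight t) (r * weight t u) (C `&` cell u).
  move=> r1; apply: contrapT => nuC.
  have [C0|/set0P[x [[Kx nWx] ux]]] := eqVneq (C `&` cell u) set0.
    apply: nuC; exists set0; split=> //; first by rewrite C0.
    by rewrite esum_set0 lee_fin mulr_ge0// ltW// (lt_trans ltr01).
  (* The removed cell [v] is deep enough to fit into the excess that [r > 1] allows. *)
  have [k0 k0P] : exists k0, expR (- t * a k0) <= (r - 1) * weight t u.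
    by apply: weight_small => //; rewrite mulr_gt0 ?subr_gt0 ?weight_gt0.
  pose k := maxn k0 u.1.+1.
  pose v := (k, q k x).
  have vP : weight t v <= (r - 1) * weight t u.
    apply: le_trans k0P; rewrite ler_expR !mulNr lerN2.
    by apply: ler_wpM2l; [exact: ltW|apply: a_homo; exact: leq_maxl].
  have uk : (u.1 < k)%N by exact: leq_maxr.
  have [B [_ CB Bc]] : ncovered t c (K `\` (W `|` cell v)).
    have : ~ P (W `|` cell v).
      apply: Wmax; split; first by move=> s Ws; left.
      by move=> /(_ x)WW; apply/nWx/WW; right.
    move=> /not_andP[[]|/contrapT//].
    by apply: openU => //; exact: q_open.
  have cov_le j y1 : cell v y1 -> (j <= k)%N -> q j y1 = q j x.
    by move=> vy jk; apply: (q_refine_le q_refine jk).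
  have nBj j : (j <= u.1)%N -> ~ B (j, q j x).
    move=> ju Bj; apply: ncW; exists B; split=> // s [Ks nWs].
    have [vs|nvs] := pselect (cell v s); last by apply: CB; split=> // -[].
    exists (j, q j x) => //; apply: cov_le => //.
    exact/(leq_trans ju)/ltnW.
  (* The cells of [B] strictly below [u]. If they weighed at most as much as [u], adding [v] would
     give the desired cover; otherwise exchanging them for [u] covers [C] at weight at most [c]. *)
  pose B1 := B `&` [set b | (u.1 < b.1)%N /\ exists2 s, cell u s & cell b s].
  have B1big : ((weight t u)%:E < \esum_(b in B1) (weight t b)%:E)%E.
    rewrite ltNge; apply/negP => B1c; apply: nuC; exists (B1 `|` [set v]); split.
    - by move=> b [[_ []]|->].
    - move=> s [[Ks nWs] us]; have [vs|nvs] := pselect (cell v s).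
        by exists v => //; right.
      have [|b Bb bs] := CB s; first by split=> // -[].
      exists b => //; left; split=> //; split; last by exists s.
      rewrite ltnNge; apply/negP => bu; apply: (nBj b.1 bu).
      have -> : q b.1 x = b.2.
        by rewrite -bs; apply: (q_refine_le q_refine bu); rewrite us.
      by case: (b) Bb.
    - apply: le_trans (esum_setU_le _ _ _) _; first by move=> b; rewrite lee_fin.
      rewrite esum_set1 ?lee_fin//; apply: le_trans (leeD B1c (_ : _ <= ((r - 1) * weight t u)%:E)%E) _.
        by rewrite lee_fin.
      by rewrite -EFinD lee_fin mulrBl mul1r addrC subrK.
  apply: ncW; exists ((B `\` B1) `|` [set u]); split=> //.
  - move=> s [Ks nWs]; have [us|nus] := pselect (cell u s).
      by exists u => //; right.
    have [|b Bb bs] := CB s.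
      split=> // -[//|vs]; apply: nus.
      exact: etrans (cov_le u.1 s vs (ltnW uk)) ux.
    exists b => //; left; split=> // -[_ [ub [s' us' bs']]]; apply: nus.
    apply: etrans us'; apply: (q_refine_le q_refine (ltnW ub)).
    exact: etrans bs (esym bs').
  - apply: le_trans (esum_setU_le _ _ _) _; first by move=> b; rewrite lee_fin.
    rewrite esum_set1 ?lee_fin//; apply: le_trans Bc.
    rewrite [leRHS](esumID B1); last by move=> b _; rewrite lee_fin.
    rewrite addeC; apply: leeD => //.
    by rewrite setIidr ?ltW// => b [].
exists C; split.
- by move=> s [[]].
- move=> s ts.
  have [K0 K00 CK0] : exists2 K0, 0 < K0 &
      covered [set u | (0 <= u.1)%N] cell (weight t) K0 C.
    have [| |l [_ Kl]] := @compact_finite_cover _ K _ setT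
      (fun l => cell (0, l)) K_compact.
    - by move=> l _; exact: q_open.
    - by move=> x _; exists (q 0 x).
    exists (\sum_(u <- fset_set [set (0, x) | x in [set` l]]) weight t u + 1).
      by rewrite ltr_wpDl// sumr_ge0.
    exists [set (0, x) | x in [set` l]]; split=> //.
      by move=> x [/Kl[i il ix] _]; exists (0, i) => //; exists i.
    rewrite esum_fset; first last.
    - by move=> u _; rewrite lee_fin.
    - exact/finite_image.
    rewrite fsumEFin; last exact/finite_image.
    rewrite lee_fin fsbig_finite/=; last exact/finite_image.
    by rewrite lerDl.
  apply: (nnull_deep a_homo a_unbounded ts (c := K0 + 1)) => L.
  (* Each level deeper costs a factor that [local_cover] allows to be any number above 1. The
     induction hypothesis is used at the midpoint of [K0] and [K1], which leaves room for one more
     factor. *)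
  suff : forall K1, K0 < K1 ->
      covered [set u | (L <= u.1)%N] cell (weight t) K1 C.
    by apply; rewrite ltrDl.
  elim: L => [K1 K01|L IH K1 K01].
    by apply: sub_covered CK0 => //; exact: ltW.
  have [B [BL CB Bc]] := IH ((K0 + K1) / 2) (midf_lt K01).1.
  have mid0 : 0 < (K0 + K1) / 2 by rewrite divr_gt0// addr_gt0// (lt_trans K00).
  have r1 : 1 < K1 / ((K0 + K1) / 2).
    by rewrite ltr_pdivlMr// mul1r (midf_lt K01).2.
  have /choice[r rP] := fun u => local_cover u _ r1.
  exists (\bigcup_(u in B) r u); split.
  - move=> v [u /BL /= Lu rv]; have [/(_ _ rv)/= uv _ _] := rP u.
    exact: leq_ltn_trans uv.
  - move=> x Cx; have [u Bu xu] := CB _ Cx.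
    have [_ /(_ x (conj Cx xu))[v rv xv] _] := rP u.
    by exists v => //; exists u.
  - rewrite -[K1](divfK (lt0r_neq0 mid0)).
    apply: (@le_trans _ _
      (\esum_(u in B) (K1 / ((K0 + K1) / 2) * weight t u)%:E)%E).
      apply: esum_bigcup_le => [v|u _]; first by rewrite lee_fin.
      by have [] := rP u.
    apply: esum_scale_le Bc => //.
    by apply: ltW; apply: lt_trans r1.
- move=> nC; have := nC c c0; exact: ncW.
Qed.

End NetBaire.

(** * The Ornstein-Weiss lemma *)

Section OrnsteinWeiss.
Local Open Scope fset_scope.
Local Open Scope ring_scope.
Context (R : realType) (G : groupType).
Implicit Types (A B C T D P : {fset G}) (c s : G).

Definition rshift_fset T c : {fset G} := [fset (t * c)%g | t in T].

Definition bad_fset T D : {fset G} :=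
  [fset c in D | ~~ (rshift_fset T c `<=` D)].

(** The points [x] outside [T] whose tile [T' x] meets [T]: the centers that [T'] may lose, besides
    [T] itself, when [T] is removed from a set. *)
Definition out_fset T' T : {fset G} :=
  [fset (s^-1 * t)%g | s in T', t in T] `\` T.

Lemma card_rshift T c : #|` rshift_fset T c| = #|` T|.
Proof. by apply: card_imfset => x y /mulIg. Qed.

Lemma card_fset_sum (K : choiceType) (A : {fset K}) (p : pred K) :
  #|` [fset x in A | p x]| = (\sum_(x <- A) p x)%N.
Proof.
by rewrite card_fset_sum1 big_fset/= big_mkcond; apply: eq_bigr => x _; case: (p x).
Qed.

(** Double counting: for fixed [t] in [T], a point of [P] equals [t * c] for at most one [c]. *)
Lemma rshift_card_sum C T P :
  (\sum_(c <- C) #|` rshift_fset T c `&` P| <= #|` T| * #|` P|)%N.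
Proof.
have cardE c : #|` rshift_fset T c `&` P| = (\sum_(t <- T) ((t * c)%g \in P))%N.
  rewrite -card_fset_sum.
  have -> : rshift_fset T c `&` P = rshift_fset [fset t in T | (t * c)%g \in P] c.
    apply/fsetP => x; rewrite !inE; apply/andP/imfsetP => /=.
      move=> [/imfsetP[t /= tT ->] tP]; exists t => //.
      by rewrite !inE tT.
    by move=> [t]; rewrite !inE => /andP[tT tP] ->; split=> //; apply/imfsetP; exists t.
  exact: card_rshift.
under eq_bigr do rewrite cardE.
rewrite exchange_big/=.
apply: (@leq_trans (\sum_(t <- T) #|` P|)%N); last first.
  by rewrite big_const_seq count_predT iter_addn_0 mulnC.
apply: leq_sum => t _; rewrite -card_fset_sum.
apply: (@leq_trans #|` [fset (t * c)%g | c in [fset c in C | (t * c)%g \in P]]|).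
  by apply: eq_leq; apply/esym; apply: card_imfset => x y /mulgI.
apply/fsubset_leq_card/fsubsetP => x /imfsetP[c /=].
by rewrite !inE => /andP[_ cP] ->.
Qed.

Context (f : {fset G} -> R).
Hypothesis f0 : f fset0 = 0.
Hypothesis fU : forall A B, f (A `|` B) <= f A + f B.
Hypothesis f_rshift : forall A c, f (rshift_fset A c) <= f A.

Lemma subadd_card A : f A <= f [fset 1%g] * #|` A|%:R.
Proof.
elim/finSet_rect: A => A IH.
have [->|/fset0Pn[x xA]] := eqVneq A fset0; first by rewrite f0 cardfs0 mulr0.
rewrite -(fsetD1K xA) cardfsU1 !inE eqxx/= natrD mulrDr mulr1.
apply: le_trans (fU _ _) (lerD _ (IH _ (fproperD1 xA))).
have -> : [fset x] = rshift_fset [fset 1%g] x.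
  apply/fsetP => y; rewrite inE; apply/eqP/imfsetP => /= [->|[z /[!inE] /eqP-> ->]].
    by exists 1%g; rewrite ?inE ?mul1g.
  by rewrite mul1g.
exact: f_rshift.
Qed.

(** Translates of [T] inside [D] are added as long as one meets the union [P] in less than a
    proportion [e]. Each of the [m] translates brings at least $(1-e)|T|$ new points, so the process
    stops. *)
Lemma greedy_packing (e : R) T D : 0 < e -> e < 1 -> T != fset0 ->
  exists P m, [/\ P `<=` D, m%:R * ((1 - e) * #|` T|%:R) <= #|` P|%:R,
    f P <= m%:R * f T,
    forall T', (#|` bad_fset T' (D `\` P)| <= #|` bad_fset T' D| + m * #|` out_fset T' T|)%N &
    forall c, c \in D -> rshift_fset T c `<=` D ->
      e * #|` T|%:R <= #|` rshift_fset T c `&` P|%:R].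
Proof.
move=> e0 e1 T0.
have T_gt0 : 0 < #|` T|%:R :> R by rewrite ltr0n cardfs_gt0.
suff H n P m : P `<=` D -> (#|` D| - #|` P| < n)%N ->
    m%:R * ((1 - e) * #|` T|%:R) <= #|` P|%:R -> f P <= m%:R * f T ->
    (forall T', #|` bad_fset T' (D `\` P)| <=
      #|` bad_fset T' D| + m * #|` out_fset T' T|)%N ->
    exists P m, [/\ P `<=` D, m%:R * ((1 - e) * #|` T|%:R) <= #|` P|%:R,
    f P <= m%:R * f T,
    forall T', (#|` bad_fset T' (D `\` P)| <= #|` bad_fset T' D| + m * #|` out_fset T' T|)%N &
    forall c, c \in D -> rshift_fset T c `<=` D ->
      e * #|` T|%:R <= #|` rshift_fset T c `&` P|%:R].
  apply: (H #|` D|.+1 fset0 0%N); rewrite ?mul0r ?cardfs0 ?subn0 ?f0//.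
  by move=> T'; rewrite fsetD0 mul0n addn0.
elim: n P m => [//|n IH] P m PD Pn Pm fP badP.
have [[c cD [TcD Tce]]|maxP] := pselect (exists2 c, c \in D &
    rshift_fset T c `<=` D /\ #|` rshift_fset T c `&` P|%:R < e * #|` T|%:R); last first.
  exists P, m; split=> // c cD TcD; rewrite leNgt; apply/negP => lt.
  by apply: maxP; exists c.
have P'D : P `|` rshift_fset T c `<=` D by rewrite fsubUset PD.
have cardP' : #|` P|%:R + (1 - e) * #|` T|%:R <= #|` P `|` rshift_fset T c|%:R :> R.
  rewrite cardfsU natrB; last exact/(leq_trans (fsubset_leq_card (fsubsetIl _ _)))/leq_addr.
  rewrite natrD card_rshift fsetIC -addrA lerD2l mulrBl mul1r lerD2l lerN2.
  exact: ltW.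
have P'big : (#|` P| < #|` P `|` rshift_fset T c|)%N.
  rewrite -(ltr_nat R); apply: lt_le_trans cardP'.
  by rewrite ltrDl mulr_gt0// subr_gt0.
apply: (IH (P `|` rshift_fset T c) m.+1) => //.
- rewrite ltnS in Pn; apply: leq_trans (ltn_sub2l _ P'big) Pn.
  exact: leq_trans P'big (fsubset_leq_card P'D).
- by rewrite -natr1 mulrDl mul1r; apply: le_trans cardP'; rewrite lerD2r.
- rewrite -natr1 mulrDl mul1r; apply: le_trans (fU _ _) _.
  by apply: lerD => //; exact: f_rshift.
- move=> T'; apply: (@leq_trans (#|` bad_fset T' (D `\` P)| + #|` out_fset T' T|)); last first.
    by rewrite mulSnr addnA leq_add2r.
  rewrite -(card_rshift (out_fset T' T) c).
  (* A center of [T'] that becomes bad when [T c] is removed lies outside [T c], while its tile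
     meets [T c]. *)
  apply: leq_trans (fsubset_leq_card (_ : _ `<=` bad_fset T' (D `\` P) `|`
    rshift_fset (out_fset T' T) c)) _; last by rewrite cardfsU leq_subr.
  apply/fsubsetP => x; rewrite !inE /= negb_or => /andP[/andP[/andP[xP xTc] xD] nsub].
  rewrite xP xD/=; have [sub|//] := boolP (rshift_fset T' x `<=` D `\` P).
  move: nsub => /fsubsetPn[_ /imfsetP[s /= sT' ->]].
  have : (s * x)%g \in D `\` P by apply: (fsubsetP sub); apply/imfsetP; exists s.
  rewrite !inE => /andP[sxP ->]; rewrite (negPf sxP) andbT negbK/=.
  move=> /imfsetP[t /= tT sxt].
  apply/imfsetP; exists (s^-1 * t)%g => /=; last by rewrite -mulgA -sxt mulKg.
  rewrite !inE; apply/andP; split; last by apply/imfset2P; exists s => //; exists t.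
  apply: contra xTc => stT; apply/imfsetP; exists (s^-1 * t)%g => //.
  by rewrite -mulgA -sxt mulKg.
Qed.
(* The tiles of [ts] are packed greedily, one after the other, each being almost
   invariant under the following ones. Invariance costs [b + 2 * beta * #|P|],
   and each tile covers a proportion [e] of what is left. *)
Lemma quasi_tiling (e mu beta : R) (ts : seq {fset G}) D (b : R) :
  0 < e -> e <= 2^-1 -> 0 <= mu -> 0 <= beta ->
  {in ts, forall T, T != fset0 /\ f T <= mu * #|` T|%:R} ->
  pairwise (fun T T' => #|` out_fset T' T|%:R <= beta * #|` T|%:R) ts ->
  {in ts, forall T, #|` bad_fset T D|%:R <= b} ->
  exists P, [/\ P `<=` D, f P <= mu / (1 - e) * #|` P|%:R &
    #|` D `\` P|%:R - b - 2 * beta * #|` P|%:R <=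
      (1 - e) ^+ size ts * (#|` D|%:R - b)].
Proof.
move=> e0 e2 mu0 beta0.
have e1 : 0 < 1 - e by lra.
elim: ts D b => [|T ts IH] D b tsP /=.
  move=> _ _; exists fset0; rewrite fsub0set f0 cardfs0 fsetD0 !mulr0 subr0 expr0.
  by rewrite mul1r lexx.
move=> /andP[/allP Tts pts] bad.
have [T0 fT] := tsP T (mem_head _ _).
have T_gt0 : 0 < #|` T|%:R :> R by rewrite ltr0n cardfs_gt0.
have e_lt1 : e < 1 by lra.
have [P1 [m [P1D mP1 fP1 badP1 maxP1]]] := greedy_packing D e0 e_lt1 T0.
have P1big : e * (#|` D|%:R - b) <= #|` P1|%:R.
  pose C := D `\` bad_fset T D.
  (* The final condition of the packing is summed over the centers at which [T] fits, then compared
     with the double count. *)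
  have : e * #|` T|%:R * #|` C|%:R <= #|` T|%:R * #|` P1|%:R.
    rewrite -natrM; apply: le_trans (_ : (\sum_(c <- C) #|` rshift_fset T c `&` P1|)%:R <= _); last first.
      by rewrite ler_nat rshift_card_sum.
    rewrite natr_sum [#|` C|]card_fset_sum1 natr_sum mulr_sumr big_seq [leRHS]big_seq.
    apply: ler_sum => c; rewrite !inE mulr1 => /andP[]; rewrite negb_and negbK.
    by move=> + cD; rewrite cD/=; exact: maxP1.
  rewrite [e * _]mulrC -mulrA ler_pM2l//; apply: le_trans.
  rewrite ler_pM2l// cardfsDS; last by apply/fsubsetP => c; rewrite !inE => /andP[].
  rewrite natrB; last by apply/fsubset_leq_card/fsubsetP => c; rewrite !inE => /andP[].
  by rewrite lerD2l lerN2 bad ?mem_head.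
(* As [e] is at most one half, the translates overlap little enough for their total size to be at
   most twice that of the union. *)
have mT : m%:R * #|` T|%:R <= 2 * #|` P1|%:R :> R.
  have half (x p : R) : 0 <= x -> x * (1 - e) <= p -> x <= 2 * p.
    move=> x0 xp.
    have : x * 2^-1 <= x * (1 - e) by apply: ler_wpM2l => //; lra.
    lra.
  by apply: half; rewrite ?mulr_ge0// -mulrA [_ * (1 - e)]mulrC.
have [T' T't||T' T't|P2 [P2D fP2 P2b]] := IH (D `\` P1) (b + 2 * beta * #|` P1|%:R).
- by apply: tsP; rewrite inE T't orbT.
- exact: pts.
- apply: le_trans (_ : (#|` bad_fset T' D| + m * #|` out_fset T' T|)%N%:R <= _).
    by rewrite ler_nat.
  rewrite natrD natrM; apply: lerD; first by apply: bad; rewrite inE T't orbT.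
  have := ler_wpM2l (ler0n R m) (Tts _ T't).
  move/le_trans; apply.
  by rewrite mulrCA [2 * _]mulrC -mulrA ler_wpM2l// mT.
have disj : [disjoint P1 & P2]%fset.
  rewrite -fsetI_eq0; apply/eqP/fsetP => x; rewrite !inE.
  apply/negP => /andP[xP1 /(fsubsetP P2D)]; rewrite !inE xP1//.
have cardU : #|` P1 `|` P2|%:R = #|` P1|%:R + #|` P2|%:R :> R.
  by rewrite cardfsU; move: disj; rewrite -fsetI_eq0 => /eqP->; rewrite cardfs0 subn0 natrD.
exists (P1 `|` P2); split.
- by rewrite fsubUset P1D (fsubset_trans P2D)// fsubDset fsubsetUr.
- rewrite cardU mulrDr; apply: le_trans (fU _ _) (lerD _ fP2).
  apply: le_trans fP1 _; rewrite mulrAC ler_pdivlMr//.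
  apply: le_trans (ler_wpM2r (ltW e1) (ler_wpM2l (ler0n R m) fT)) _.
  rewrite mulrCA -!mulrA; apply: (ler_wpM2l mu0).
  by rewrite [_ * (1 - e)]mulrC.
- rewrite cardU fsetDDl in P2b *.
  have cD : #|` D `\` P1|%:R = #|` D|%:R - #|` P1|%:R :> R.
    by rewrite cardfsDS// natrB// fsubset_leq_card.
  rewrite mulrDr; apply: le_trans (_ : (1 - e) ^+ size ts *
     (#|` D `\` P1|%:R - (b + 2 * beta * #|` P1|%:R)) <= _); first by lra.
  rewrite exprSr -[leRHS]mulrA; apply: ler_wpM2l; first by rewrite exprn_ge0// ltW.
  rewrite cD.
  have : 0 <= 2 * beta * #|` P1|%:R by rewrite !mulr_ge0.
  lra.
Qed.
End OrnsteinWeiss.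

Lemma near_all_seq (K : eqType) (T : Type) (Phi : set_system T)
    {FPhi : Filter Phi} (r : seq K) (P : K -> T -> Prop) :
  (forall x, x \in r -> \forall n \near Phi, P x n) ->
  \forall n \near Phi, forall x, x \in r -> P x n.
Proof.
elim: r => [|x r IH] H; first exact: nearW.
have Hx := H x (mem_head _ _).
have Hr : \forall n \near Phi, forall y, y \in r -> P y n.
  by apply: IH => y yr; apply: H; rewrite inE yr orbT.
by apply: filterS2 Hx Hr => n Px Pr y; rewrite inE => /orP[/eqP->//|/Pr].
Qed.

(** * Convergence of subadditive averages along Følner sequences *)

Section Folner.
Local Open Scope fset_scope.
Local Open Scope ring_scope.
Context (R : realType) (G : groupType) (F : nat -> {fset G}).
Implicit Types (A B T : {fset G}).
Hypothesis hF : folner_seq R F.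

Lemma folner_card_gt0 n : 0 < #|` F n|%:R :> R.
Proof. by rewrite ltr0n cardfs_gt0; have [] := hF. Qed.

Lemma folner_symdiff s (b : R) : 0 < b -> \forall n \near \oo,
  #|` symdiff_fset (F n) (lshift_fset s (F n))|%:R <= b * #|` F n|%:R.
Proof.
move=> b0; have [_ /(_ s)/cvgr0Pnorm_lt/(_ b b0)] := hF.
apply: filterS => n; rewrite ger0_norm ?divr_ge0// => /ltW.
by rewrite ler_pdivrMr// folner_card_gt0.
Qed.

Lemma card_bigfcup_le (K L : choiceType) (A : {fset K}) (f : K -> {fset L}) :
  (#|` \bigcup_(x <- A) f x| <= \sum_(x <- A) #|` f x|)%N.
Proof.
apply: (big_ind2 (fun (B : {fset L}) m => #|` B| <= m)%N) => //.
move=> B m B' m' Bm Bm'; apply: leq_trans (leq_add Bm Bm').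
by rewrite cardfsU leq_subr.
Qed.

(** Each of the $|T|$ symmetric differences is eventually at most a fraction $b/(|T|+1)$ of
    $|F_n|$. *)
Lemma folner_bigcup (T : {fset G}) (h : nat -> {fset G}) (b : R) : 0 < b ->
  (forall n, h n `<=`
    \bigcup_(s <- T) symdiff_fset (F n) (lshift_fset s^-1 (F n))) ->
  \forall n \near \oo, #|` h n|%:R <= b * #|` F n|%:R.
Proof.
move=> b0 sub; pose d := b / (#|` T|%:R + 1).
have d0 : 0 < d by rewrite divr_gt0// ltr_wpDl.
have [N _ HN] := near_all_seq (Phi := \oo) (r := enum_fset T)
  (fun s _ => folner_symdiff s^-1 d0).
exists N => // n /HN /= {}HN.
have /(leq_trans (fsubset_leq_card (sub n))) := card_bigfcup_le T
  (fun s => symdiff_fset (F n) (lshift_fset s^-1 (F n))).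
rewrite -(ler_nat R) natr_sum => /le_trans; apply.
apply: (@le_trans _ _ (\sum_(s <- T) d * #|` F n|%:R)).
  by rewrite big_seq [leRHS]big_seq; apply: ler_sum => s; exact: HN.
rewrite big_const_seq count_predT iter_addr_0 -mulrnAl.
apply: ler_wpM2r => //; rewrite -mulr_natr /d mulrAC ler_pdivrMr ?ltr_wpDl//.
by rewrite ler_pM2l// lerDl.
Qed.

Lemma folner_out T (b : R) : 0 < b ->
  \forall n \near \oo, #|` out_fset T (F n)|%:R <= b * #|` F n|%:R.
Proof.
move=> b0; apply: (folner_bigcup (T := T)) => // n.
apply/fsubsetP => x; rewrite !inE => /andP[xF /imfset2P[s /= sT [t /= tF xE]]].
apply/bigfcupP; exists s; first by rewrite andbT.
rewrite !inE xF/=; apply/orP; right.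
by apply/imfsetP; exists t.
Qed.

Lemma folner_bad T (b : R) : 0 < b ->
  \forall n \near \oo, #|` bad_fset T (F n)|%:R <= b * #|` F n|%:R.
Proof.
move=> b0; apply: (folner_bigcup (T := T)) => // n.
apply/fsubsetP => c; rewrite !inE.
move=> /andP[cF /fsubsetPn[_ /imfsetP[s /= sT ->] scF]].
apply/bigfcupP; exists s; first by rewrite andbT.
rewrite !inE cF/= andbT; apply/orP; left.
by apply: contra scF => /imfsetP[t /= tF ->]; rewrite mulVKg.
Qed.

(** For a finite set [T] with at least [m] elements, eventually at most half of the centers in [F n]
    are bad, so [F n] contains a translate of [T]. *)
Lemma folner_card_unbounded : infinite_set [set: G] ->
  forall m, \forall n \near \oo, (m <= #|` F n|)%N.
Proof.
move=> Ginf m; have [T _ Tm] := infinite_set_fset m Ginf.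
have h2 : 0 < 2^-1 :> R by [].
apply: filterS (folner_bad T h2) => n badn.
have [c cF nbad] : exists2 c, c \in F n & c \notin bad_fset T (F n).
  apply/fsubsetPn; apply/negP => /fsubset_leq_card; rewrite -(ler_nat R).
  have := folner_card_gt0 n; lra.
move: nbad; rewrite !inE cF/= negbK => /fsubset_leq_card.
by rewrite card_rshift; exact: leq_trans.
Qed.

Context (f : {fset G} -> R).
Hypothesis f_ge0 : forall A, 0 <= f A.
Hypothesis f0 : f fset0 = 0.
Hypothesis fU : forall A B, f (A `|` B) <= f A + f B.
Hypothesis f_rshift : forall A c, f (rshift_fset A c) <= f A.

(** The list is built from its end: each new head is a later [F n], almost invariant under all tiles
    already chosen. *)
Lemma exists_tiles (mu beta : R) k : 0 < beta ->
  (forall N, exists2 n, (N <= n)%N & f (F n) < mu * #|` F n|%:R) ->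
  exists ts : seq {fset G}, [/\ size ts = k,
    {in ts, forall T, T != fset0 /\ f T <= mu * #|` T|%:R} &
    pairwise (fun T T' => #|` out_fset T' T|%:R <= beta * #|` T|%:R) ts].
Proof.
move=> b0 io; elim: k => [|k [ts [sz tsP pts]]]; first by exists [::]; split.
have [N _ HN] := near_all_seq (Phi := \oo) (r := ts) (fun T _ => folner_out T b0).
have [n Nn fn] := io N; exists (F n :: ts); split=> /=; first by rewrite sz.
  move=> T; rewrite inE => /orP[/eqP->|/tsP//]; split; last exact: ltW.
  by have [] := hF.
by rewrite pts andbT; apply/allP => T; exact: HN.
Qed.

(** Finitely many tiles of average at most [mu] quasi-tile every late [F n]; each point left over
    costs at most the value [C] of [f] at a singleton. *)
Lemma ornstein_weiss_limsup (mu eta : R) : 0 < eta -> 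
  (forall N, exists2 n, (N <= n)%N & f (F n) / #|` F n|%:R < mu) ->
  \forall n \near \oo, f (F n) / #|` F n|%:R < mu + eta.
Proof.
move=> eta0 io.
have mu0 : 0 <= mu.
  have [n _ /ltW] := io 0; apply: le_trans; by rewrite divr_ge0.
pose C := f [fset 1%g].
have C0 : 0 <= C by exact: f_ge0.
(* Chosen so that the loss from overlaps satisfies $\mu/(1-e) \le \mu + \eta/4$. *)
pose e := Num.min 2^-1 (eta / (8 * (mu + 1))).
have e0 : 0 < e by rewrite lt_min invr_gt0 ltr0n/= divr_gt0// mulr_gt0// ltr_wpDl.
have e2 : e <= 2^-1 by rewrite ge_min lexx.
have emu : mu * e <= eta / 8.
  apply: le_trans (_ : mu * (eta / (8 * (mu + 1))) <= _).
    by apply: ler_wpM2l => //; rewrite ge_min lexx orbT.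
  rewrite mulrA ler_pdivrMr ?mulr_gt0// ?ltr_wpDl//; lra.
(* The uncovered proportion will be at most $3b + d/4 = 3d/4$, at a cost of at most $3\eta/8$ per
   point of $F_n$. *)
pose d := eta / (2 * (C + 1)).
have d0 : 0 < d by rewrite divr_gt0// mulr_gt0// ltr_wpDl.
have dC : C * d <= eta / 2.
  rewrite /d mulrA ler_pdivrMr ?mulr_gt0// ?ltr_wpDl//; lra.
pose b := d / 6.
have b0 : 0 < b by rewrite divr_gt0.
have [k kP] : exists k, (1 - e) ^+ k <= d / 4.
  have e1 : `|1 - e| < 1 by rewrite ger0_norm; lra.
  have /cvgr0Pnorm_le/(_ (d / 4)) := cvg_expr e1.
  case; first by rewrite divr_gt0.
  by move=> k _ /(_ k (leqnn k)); exists k; exact: le_trans (ler_norm _) _.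
have [|ts [tsk tsP pts]] := @exists_tiles mu b k b0.
  move=> N; have [n Nn fn] := io N; exists n => //.
  by rewrite -ltr_pdivrMr// folner_card_gt0.
have [N _ HN] := near_all_seq (Phi := \oo) (r := ts) (fun T _ => folner_bad T b0).
exists N => // n /HN /= bad; rewrite ltr_pdivrMr ?folner_card_gt0//.
have [P [PD fP DP]] := quasi_tiling f0 fU f_rshift e0 e2 mu0 (ltW b0) tsP pts bad.
have cP : #|` P|%:R <= #|` F n|%:R :> R by rewrite ler_nat fsubset_leq_card.
have D_gt0 := folner_card_gt0 n.
have fD : f (F n) <= f P + C * #|` F n `\` P|%:R.
  have FE : F n = P `|` (F n `\` P).
    apply/fsetP => x; rewrite !inE.
    by have [/(fsubsetP PD)->|] := boolP (x \in P).
  rewrite {1}FE; apply: le_trans (fU _ _) (lerD (lexx _) _).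
  exact: (subadd_card f0 fU f_rshift).
have e1 : 0 < 1 - e by lra.
have rD : #|` F n `\` P|%:R <= (3 * (d / 4)) * #|` F n|%:R.
  have h1 : (1 - e) ^+ size ts * (#|` F n|%:R - b * #|` F n|%:R) <= d / 4 * #|` F n|%:R.
    rewrite tsk; apply: (@le_trans _ _ ((1 - e) ^+ k * #|` F n|%:R)).
      apply: ler_wpM2l; first by rewrite exprn_ge0// ltW.
      by rewrite gerBl mulr_ge0// ltW.
    by apply: ler_wpM2r.
  have h2 : 2 * b * #|` P|%:R <= 2 * b * #|` F n|%:R.
    by apply: ler_wpM2l => //; rewrite mulr_ge0// ltW.
  move: DP h1 h2; rewrite /b; lra.
have muP : mu / (1 - e) <= mu + eta / 4.
  rewrite ler_pdivrMr//; nra.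
have fP' : f P <= (mu + eta / 4) * #|` F n|%:R.
  apply: le_trans fP _; apply: ler_pM => //; rewrite divr_ge0//; exact: ltW.
have CD : C * #|` F n `\` P|%:R <= 3 / 8 * eta * #|` F n|%:R.
  apply: le_trans (ler_wpM2l C0 rD) _.
  have : C * (3 * (d / 4)) <= 3 / 8 * eta by move: dC; lra.
  by move=> /(ler_wpM2r (ltW D_gt0)); rewrite -[leLHS]mulrA.
apply: le_lt_trans fD _; apply: le_lt_trans (lerD fP' CD) _.
rewrite -mulrDl ltr_pM2r//; lra.
Qed.

(** The infimum of [io] is the lower limit of the averages; the previous lemma bounds the upper
    limit by it. *)
Lemma ornstein_weiss : cvgn (fun n => f (F n) / #|` F n|%:R).
Proof.
pose u n := f (F n) / #|` F n|%:R.
pose io := [set mu | forall N, exists2 n, (N <= n)%N & u n < mu].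
have u0 n : 0 <= u n by rewrite divr_ge0.
have uC n : u n <= f [fset 1%g].
  by rewrite ler_pdivrMr ?folner_card_gt0// (subadd_card f0 fU f_rshift).
have io_inf : has_inf io.
  split; last by exists 0 => mu /(_ 0)[n _ /ltW]; exact: le_trans.
  exists (f [fset 1%g] + 1) => N; exists N => //.
  by apply: le_lt_trans (uC N) _; rewrite ltrDl.
apply/cvg_ex; exists (inf io); apply/cvgrPdist_lt => e e0.
have e20 : 0 < e / 2 by rewrite divr_gt0.
have [mu iomu mulT] := inf_adherent e20 io_inf.
have low : \forall n \near \oo, inf io - e < u n.
  apply: contrapT => nlow.
  suff : io (inf io - e / 2) by move=> /(ge_inf io_inf.2); lra.
  move=> N; apply: contrapT => /forall2NP H; apply: nlow.
  exists N => // n /= Nn; have [//|] := H n.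
  by move/negP; rewrite -leNgt => h; apply: lt_le_trans h; lra.
have := ornstein_weiss_limsup e20 iomu; apply: filterS2 low => n low up.
rewrite -/(u n) in up *; rewrite distrC ltr_distl; apply/andP; split => //.
by apply: lt_trans up _; lra.
Qed.
End Folner.

(** * Cover numbers *)

Section CoverJoin.
Context (R : realType) (X : metricType R) (G : groupType) (act : G -> X -> X).
Implicit Types (U V : set (set X)) (A B : {fset G}).

(** A family indexed by [A] is presented as the restriction of a function on all of [G], which keeps
    dependent types out of the arguments on joins. *)
Definition word A (p : G -> set X) : set_family X G :=
  existT (fun A : {fset G} => {ffun A -> set X}) A [ffun g => p (val g)].

Lemma fam_set_word A p :
  fam_set act (word A p) = [set x | forall g, g \in A -> p g (act g x)].
Proof.
apply/seteqP; split=> x /= H => [g gA|g _ /=].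
  by have := H [` gA]%fset I; rewrite /fam_fun/= ffunE.
rewrite /fam_fun/= ffunE; exact/H/fsvalP.
Qed.

Lemma families_word U A p :
  (forall g, g \in A -> U (p g)) -> families U A (word A p).
Proof.
by move=> H; split=> // g; rewrite /fam_fun/= ffunE; exact/H/fsvalP.
Qed.

Lemma familiesP U A (u : set_family X G) : families U A u ->
  exists2 p, (forall g, g \in A -> U (p g)) & u = word A p.
Proof.
case: u => B w [/= E]; subst B => Uw.
exists (fun g => if insub g is Some h then w h else setT).
  by move=> g gA; rewrite (insubT (fun g => g \in A) gA); exact: Uw.
congr existT; apply/ffunP => g; rewrite ffunE.
by rewrite (insubT (fun g => g \in A) (fsvalP g)); congr (w _); exact: val_inj.
Qed.

Lemma cover_joinP U A Z : cover_join act U A Z <->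
  exists2 p, (forall g, g \in A -> U (p g)) &
    Z = [set x | forall g, g \in A -> p g (act g x)].
Proof.
split=> [[u /familiesP[p pU ->] <-]|[p pU ->]].
  by exists p => //; exact: fam_set_word.
by exists (word A p); [exact: families_word|exact: fam_set_word].
Qed.

Lemma finite_families U A : finite_set U -> finite_set (families U A : set (set_family X G)).
Proof.
move=> finU.
pose h (w : {ffun A -> fset_set U}) : set_family X G :=
  existT (fun A : {fset G} => {ffun A -> set X}) A [ffun g => val (w g)].
apply: (@sub_finite_set _ _ (h @` setT)); last exact: finite_image.
move=> u /familiesP[p pU ->].
have pU' (g : A) : p (val g) \in fset_set U.
  by rewrite in_fset_set// inE; exact/pU/fsvalP.
exists [ffun g => [` pU' g]%fset] => //; congr existT.
by apply/ffunP => g; rewrite !ffunE.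
Qed.

Lemma finite_cover_join U A : finite_set U -> finite_set (cover_join act U A).
Proof. by move=> finU; apply: finite_image; exact: finite_families. Qed.

Lemma cover_join_mem U A x :
  \bigcup_(Z in U) Z = setT -> exists2 Z, cover_join act U A Z & Z x.
Proof.
move=> covU.
have /choice[p pP] : forall g, exists Z, U Z /\ Z (act g x).
  by move=> g; have : setT (act g x) by []; rewrite -covU => -[Z ? ?]; exists Z.
exists [set y | forall g, g \in A -> p g (act g y)].
  by apply/cover_joinP; exists p => // g _; have [] := pP g.
by move=> g _; have [] := pP g.
Qed.

Definition covers_by (VA : set (set X)) (Z : set X) (W : {fset (set X)}) :=
  [set` W] `<=` VA /\ Z `<=` \bigcup_(A in [set` W]) A.

Lemma cover_num_le VA Z W : covers_by VA Z W -> cover_num VA Z <= #|` W|%:R.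
Proof.
move=> cW; apply: ge_inf; last by exists W.
by exists 0 => _ [W' _ <-].
Qed.

Lemma cover_num_attained VA Z W : covers_by VA Z W ->
  exists2 W', covers_by VA Z W' & #|` W'|%:R = cover_num VA Z.
Proof.
move=> cW.
have ex : exists n, `[< exists2 W', covers_by VA Z W' & #|` W'| = n >].
  by exists #|` W|; apply/asboolP; exists W.
case: (ex_minnP ex) => n /asboolP[W' cW' W'n] nmin; exists W' => //.
apply/le_anti/andP; split; last exact: cover_num_le.
apply: lb_le_inf; first by exists #|` W|%:R, W.
move=> _ [W'' cW'' <-]; rewrite ler_nat W'n; apply: nmin.
by apply/asboolP; exists W''.
Qed.

Lemma cond_cover_num_le VA UA c : UA !=set0 ->
  (forall Z, UA Z -> exists2 W, covers_by VA Z W & #|` W|%:R <= c) ->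
  cond_cover_num VA UA <= c.
Proof.
move=> [Z0 UZ0] H; apply: ge_sup; first by exists (cover_num VA Z0), Z0.
by move=> _ [Z /H[W cW Wc] <-]; apply: le_trans Wc; exact: cover_num_le.
Qed.

Lemma cond_cover_num_ge VA UA Z : finite_set VA ->
  \bigcup_(A in VA) A = setT -> UA Z ->
  exists2 W, covers_by VA Z W & #|` W|%:R <= cond_cover_num VA UA.
Proof.
move=> finVA covVA UZ.
have cV Z' : covers_by VA Z' (fset_set VA).
  by split; rewrite fset_setK// covVA.
have [W cW WE] := cover_num_attained (cV Z); exists W => //.
rewrite WE; apply: ub_le_sup; last by exists Z.
by exists #|` fset_set VA|%:R => _ [Z' _ <-]; exact: cover_num_le.
Qed.

Section CondCoverNum.
Context (U V : set (set X)) (x0 : X).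
Hypothesis actM : forall g h x, act (g * h)%g x = act g (act h x).
Hypothesis covU : \bigcup_(Z in U) Z = setT.
Hypothesis finV : finite_set V.
Hypothesis covV : \bigcup_(Z in V) Z = setT.

(** The number $N(V_A|U_A)$. Its logarithm is nonnegative, subadditive in [A] and does not increase
    under right translation, as the Ornstein-Weiss lemma requires. *)
Definition ccn A := cond_cover_num (cover_join act V A) (cover_join act U A).

Lemma cover_join_cover W A : \bigcup_(Z in W) Z = setT ->
  \bigcup_(Z in cover_join act W A) Z = setT.
Proof.
move=> covW; apply/seteqP; split=> // x _.
by have [Z] := cover_join_mem A x covW; exists Z.
Qed.

Lemma ccn_ge A Z : cover_join act U A Z ->
  exists2 W, covers_by (cover_join act V A) Z W & #|` W|%:R <= ccn A.
Proof.
by apply: cond_cover_num_ge; [exact: finite_cover_join|exact: cover_join_cover].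
Qed.

Lemma ccn_le A c :
  (forall Z, cover_join act U A Z ->
    exists2 W, covers_by (cover_join act V A) Z W & #|` W|%:R <= c) ->
  ccn A <= c.
Proof.
apply: cond_cover_num_le; have [Z] := cover_join_mem A x0 covU; by exists Z.
Qed.

Lemma ccn_ge1 A : 1 <= ccn A.
Proof.
have [Z UZ Zx] := cover_join_mem A x0 covU.
have [W [_ ZW]] := ccn_ge UZ; apply: le_trans.
have [Y /= WY _] := ZW _ Zx.
by rewrite ler1n cardfs_gt0; apply/fset0Pn; exists Y.
Qed.

Lemma ccn0 : ccn fset0 = 1.
Proof.
apply/le_anti/andP; split; last exact: ccn_ge1.
apply: ccn_le => _ /cover_joinP[p _ ->]; exists [fset setT]%fset; last first.
  by rewrite cardfs1.
split=> [Y /=|x _]; last by exists setT => //=; rewrite inE.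
rewrite inE => /eqP->; apply/cover_joinP; exists (fun=> setT) => //.
by apply/seteqP; split.
Qed.

Lemma ccnU A B : ccn (A `|` B)%fset <= ccn A * ccn B.
Proof.
apply: ccn_le => _ /cover_joinP[p pU ->].
have [WA [WAV cWA] WAc] : exists2 W, covers_by (cover_join act V A)
    [set x | forall g, g \in A -> p g (act g x)] W & #|` W|%:R <= ccn A.
  by apply: ccn_ge; apply/cover_joinP; exists p => // g gA; apply: pU; rewrite inE gA.
have [WB [WBV cWB] WBc] : exists2 W, covers_by (cover_join act V B)
    [set x | forall g, g \in B -> p g (act g x)] W & #|` W|%:R <= ccn B.
  by apply: ccn_ge; apply/cover_joinP; exists p => // g gB; apply: pU; rewrite inE gB orbT.
have /choice[e eP] : forall ab : set X * set X, exists Z,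
    cover_join act V A ab.1 -> cover_join act V B ab.2 ->
    cover_join act V (A `|` B)%fset Z /\ ab.1 `&` ab.2 `<=` Z.
  move=> [a b] /=; have [/cover_joinP[pa paV ->]|na] := pselect (cover_join act V A a);
    last by exists set0.
  have [/cover_joinP[pb pbV ->]|nb] := pselect (cover_join act V B b);
    last by exists set0.
  (* On the overlap of [A] and [B] the word of [A] wins; the resulting set contains the
     intersection, which suffices for a cover. *)
  pose q g := if g \in A then pa g else pb g.
  exists [set x | forall g, g \in (A `|` B)%fset -> q g (act g x)] => _ _; split.
    apply/cover_joinP; exists q => // g; rewrite inE /q.
    by case: ifPn => [/paV//|_ /= /pbV].
  move=> x [ax bx] g; rewrite inE /q.
  by case: ifPn => [/ax//|_ /= /bx].
pose s := [seq e (a, b) | a <- enum_fset WA, b <- enum_fset WB].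
exists (seq_fset tt s); last first.
  apply: (@le_trans _ _ (size s)%:R).
    by rewrite ler_nat size_seq_fset size_undup.
  by rewrite size_allpairs natrM ler_pM.
split=> [Z|x Hx].
  change (Z \in seq_fset tt s -> cover_join act V (A `|` B)%fset Z).
  rewrite seq_fsetE => /allpairsP[[a b] /= [aW bW ->]].
  by have [] := eP (a, b) (WAV a aW) (WBV b bW).
have [a /= aW ax] : (\bigcup_(A in [set` WA]) A) x.
  by apply: cWA => g gA; apply: Hx; rewrite inE gA.
have [b /= bW bx] : (\bigcup_(A in [set` WB]) A) x.
  by apply: cWB => g gB; apply: Hx; rewrite inE gB orbT.
exists (e (a, b)).
  change (e (a, b) \in seq_fset tt s); rewrite seq_fsetE.
  by apply/allpairsP; exists (a, b).
by have [_] := eP (a, b) (WAV a aW) (WBV b bW); apply.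
Qed.

Lemma cover_join_rshift W A c Z : cover_join act W (rshift_fset A c) Z <->
  exists2 Z', cover_join act W A Z' & Z = act c @^-1` Z'.
Proof.
split=> [/cover_joinP[p pW ->]|[_ /cover_joinP[p pW ->] ->]].
  exists [set x | forall g, g \in A -> p (g * c)%g (act g x)].
    apply/cover_joinP; exists (fun g => p (g * c)%g) => // g gA; apply: pW.
    by apply/imfsetP; exists g.
  apply/seteqP; split=> x /= H => [g gA|_ /imfsetP[g /= gA ->]].
    by rewrite -actM; apply: H; apply/imfsetP; exists g.
  by rewrite actM; exact: H.
apply/cover_joinP; exists (fun g => p (g * c^-1)%g).
  by move=> _ /imfsetP[g /= gA ->]; rewrite mulgK; exact: pW.
apply/seteqP; split=> x /= H => [_ /imfsetP[g /= gA ->]|g gA].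
  by rewrite mulgK actM; exact: H.
have := H (g * c)%g; rewrite mulgK actM; apply.
by apply/imfsetP; exists g.
Qed.

Lemma ccn_rshift A c : ccn (rshift_fset A c) <= ccn A.
Proof.
apply: ccn_le => _ /cover_join_rshift[Z UZ ->].
have [W [WV ZW] Wc] := ccn_ge UZ.
exists [fset (act c @^-1` Y) | Y in W]%fset; last first.
  by apply: le_trans Wc; rewrite ler_nat leq_imfset_card.
split=> [_ /imfsetP[Y /= YW ->]|x Zx].
  by apply/cover_join_rshift; exists Y => //; exact: WV.
have [Y /= YW Yx] := ZW _ Zx; exists (act c @^-1` Y) => //=.
by apply/imfsetP; exists Y.
Qed.

Lemma cvg_cond_cover_num F : folner_seq R F ->
  cvgn (fun n => ln (ccn (F n)) / #|` F n|%:R).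
Proof.
move=> hF; have ccn_gt0 A : 0 < ccn A := lt_le_trans ltr01 (ccn_ge1 A).
apply: (ornstein_weiss hF (f := fun A => ln (ccn A))) => [A||A B|A c].
- by rewrite ln_ge0// ccn_ge1.
- by rewrite ccn0 ln1.
- by rewrite -lnM ?posrE// ler_ln ?posrE ?mulr_gt0// ccnU.
- by rewrite ler_ln ?posrE// ccn_rshift.
Qed.

(** Because the averages converge, a strict bound on [htop_cond] passes to all late terms. *)
Lemma htop_cond_lt F (e : R) : folner_seq R F ->
  (htop_cond act F V U < e%:E)%E ->
  \forall n \near \oo, forall Z, cover_join act U (F n) Z ->
    exists2 W, covers_by (cover_join act V (F n)) Z W &
      #|` W|%:R <= expR (e * #|` F n|%:R).
Proof.
move=> hF; have /cvg_ex[l lP] := cvg_cond_cover_num hF.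
have -> : htop_cond act F V U = l%:E.
  by apply/cvg_lim => //; apply/cvg_EFin; [exact: nearW|exact: lP].
rewrite lte_fin => le; have [N _ HN] := cvgr_lt _ lP _ le.
exists N => // n /HN /=; rewrite ltr_pdivrMr ?folner_card_gt0// => /ltW ne Z UZ.
have [W cW Wc] := ccn_ge UZ; exists W => //; apply: le_trans Wc _.
by rewrite -[leLHS]lnK ?ler_expR// posrE; apply: lt_le_trans (ccn_ge1 _).
Qed.

End CondCoverNum.
End CoverJoin.

(** * Itineraries *)

Section Centers.
Context (R : realType) (X : metricType R) (G : groupType) (act : G -> X -> X).
Implicit Types (U V : set (set X)) (A : {fset G}).

(** A closeness relation that is reflexive for a cover and symmetric, but not transitive; double
    star refinements control two links in a row. *)
Definition link V (x y : X) : Prop := exists2 B, V B & B x /\ B y.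

Definition flink V A (x y : X) : Prop :=
  forall g, g \in A -> link V (act g x) (act g y).

Lemma link_sym V x y : link V x y -> link V y x.
Proof. by move=> [B VB [Bx By]]; exists B. Qed.

Lemma link_refl V x : \bigcup_(B in V) B = setT -> link V x x.
Proof. by move=> VT; have : setT x by []; rewrite -VT => -[B VB Bx]; exists B. Qed.

Lemma cover_join_flink V A Z x y : cover_join act V A Z -> Z x -> Z y -> flink V A x y.
Proof.
by move=> /cover_joinP[p pV ->] Zx Zy g gA; exists (p g); [exact: pV|split; [exact: Zx|exact: Zy]].
Qed.

Lemma lebesgue_number U : compact [set: X] -> finite_open_cover U ->
  exists2 e : R, 0 < e & forall z, exists2 A, U A & ball z e `<=` A.
Proof.
move=> /compact_near_coveringP Xcov [_ Uop UT].
have H := Xcov R (0^'+) (fun e z => exists2 A, U A & ball z e `<=` A) _.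
have : \forall e \near 0^'+, forall z, [set: X] z -> exists2 A, U A & ball z e `<=` A.
  apply: H => z _; have : setT z by []; rewrite -UT => -[A UA Az].
  have /nbhs_ballP[r /= r0 rA] : nbhs z A.
    by apply: open_nbhs_nbhs; split => //; exact: Uop.
  have r20 : 0 < r / 2 by rewrite divr_gt0.
  exists (ball z (r / 2), [set e | e <= r / 2]).
    by split=> /=; [exact: nbhsx_ballx|exact: nbhs_right_le].
  move=> [z' e] /= [zz' er]; exists A => // y ye; apply: rA; rewrite [r]splitr.
  by apply: (ball_triangle zz'); exact: le_ball ye.
move=> He.
have [e [He0 e0]] : exists e : R, (forall z, [set: X] z -> exists2 A, U A & ball z e `<=` A) /\ 0 < e.
  apply: (@filter_ex _ (0^'+ : set_system R)).
  by apply: filterI => //; exact: nbhs_right_gt.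
by exists e => // z; exact: He0.
Qed.

(** [V] consists of interiors of balls whose radius is a quarter of a Lebesgue number [e] of [U]:
    each link spans less than [e / 2], hence two links less than [e]. *)
Lemma star_refinement U : compact [set: X] -> finite_open_cover U ->
  exists2 V, finite_open_cover V & forall z, exists2 A, U A &
    forall x y, link V z x -> link V x y -> A y.
Proof.
move=> cX fU; have [e e0 He] := lebesgue_number cX fU.
have e40 : 0 < e / 4 by rewrite divr_gt0.
have [| |s [_ sX]] := @compact_finite_cover _ _ X setT (fun z => (ball z (e / 4))°) cX.
- by move=> z _; exact: open_interior.
- by move=> z _; exists z => //; exact: nbhsx_ballx.
exists [set (ball z (e / 4))° | z in [set` s]].
  split; first exact: finite_image.
    by move=> _ [z _ <-]; exact: open_interior.
  apply/seteqP; split=> // x _; have [z zs zx] := sX x I.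
  by exists (ball z (e / 4))° => //; exists z.
have close x y : link [set (ball z (e / 4))° | z in [set` s]] x y -> ball x (e / 2) y.
  move=> [_ [z zs <-] [/interior_subset zx /interior_subset zy]].
  have -> : e / 2 = e / 4 + e / 4 by lra.
  by apply: ball_triangle zy; exact: ball_sym.
move=> z; have [A UA zA] := He z; exists A => // x y /close zx /close xy.
by apply: zA; rewrite [e]splitr; exact: ball_triangle xy.
Qed.

Lemma open_bigcup_closed (O : set X) : open O ->
  exists2 C : nat -> set X, (forall m, closed (C m)) & \bigcup_m C m = O.
Proof.
move=> oO; exists (fun m => ~` \bigcup_(z in ~` O) (ball z (m.+1%:R^-1))°).
  by move=> m; apply: open_closedC; apply: bigcup_open => z _; exact: open_interior.
apply/seteqP; split=> [x [m _ nx]|x Ox].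
  apply: contrapT => nOx; apply: nx; exists x => //.
  by apply: nbhsx_ballx; rewrite invr_gt0.
have /nbhs_ballP[r /= r0 rO] : nbhs x O by exact: open_nbhs_nbhs.
have [m mr] : exists m : nat, m.+1%:R^-1 < r.
  by have [m] := ltr_add_invr (y := 0) r0; rewrite add0r; exists m.
exists m => // -[z nOz /interior_subset zx]; apply: nOz; apply: rO.
by apply: le_ball (ball_sym zx); exact: ltW.
Qed.

Lemma flink_open V A x : (forall B, V B -> open B) ->
  (forall g, continuous (act g)) -> open [set y | flink V A x y].
Proof.
move=> Vop cact; rewrite openE => y xy.
apply: (near_all_seq (Phi := nbhs y) (r := enum_fset A)
  (P := fun g z => link V (act g x) (act g z))) => g gA.
have [B VB [Bx By]] := xy g gA.
have : nbhs y (act g @^-1` B).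
  by apply: cact; apply: open_nbhs_nbhs; split=> //; exact: Vop.
by apply: filterS => z Bz; exists B.
Qed.

(** A maximal separated set exists by Zorn's lemma. It is finite, since each element of the finite
    join of [V] contains at most one of its points, and maximality makes every point linked to
    it. *)
Lemma maximal_separated V A : finite_open_cover V ->
  exists es : seq X, (forall x, exists2 e, e \in es & flink V A e x) /\
    (forall e e', e \in es -> e' \in es -> flink V A e e' -> e = e').
Proof.
move=> [finV _ VT].
pose P := [set S : set X | forall x y, S x -> S y -> flink V A x y -> x = y].
have [C CP totC|S [PS maxS]] := @Zorn_bigcup _ P.
  move=> x y [S CS Sx] [S' CS' S'y].
  have [SS'|S'S] := totC _ _ CS CS'; first by apply: (CP _ CS') => //; exact: SS'.
  by apply: (CP _ CS) => //; exact: S'S.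
have finS : finite_set S.
  have [/eqP->//|/set0P[x0 _]] := boolP (S == set0).
  pose h (Z : set X) := xget x0 (S `&` Z).
  apply: (@sub_finite_set _ _ (h @` cover_join act V A)); last first.
    exact/finite_image/finite_cover_join.
  move=> x Sx; have [Z VZ Zx] := cover_join_mem act A x VT.
  exists Z => //; rewrite /h; case: xgetP => [y _ [Sy Zy]|/(_ x)[]//].
  by apply: PS => //; exact: cover_join_flink VZ Zy Zx.
exists (enum_fset (fset_set S)); split; last first.
  by move=> e e'; rewrite !in_fset_set// !inE => Se Se'; exact: PS.
move=> x; apply: contrapT => /forall2NP H.
have nSx e : S e -> ~ flink V A e x.
  by move=> Se; have [|//] := H e; rewrite in_fset_set// inE.
apply: (maxS (S `|` [set x])).
  split; first by move=> y Sy; left.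
  move=> /(_ x) h; apply: (nSx x); first by apply: h; right.
  by move=> g _; exact: link_refl.
move=> y z [Sy|->] [Sz|->] // yz; first exact: PS.
- by case: (nSx y Sy).
- by case: (nSx z Sz) => g gA; exact/link_sym/yz.
Qed.

(** [c] picks the first center linked to the point. Its level sets are differences of open sets,
    hence countable unions of closed pieces [P n], on which [c] has the constant value [v n]; these
    pieces later make labels continuous. *)
Lemma center_system V A (x0 : X) : finite_open_cover V ->
  (forall g, continuous (act g)) ->
  exists (c : X -> X) (P : nat -> set X) (v : nat -> X),
    [/\ forall x, flink V A (c x) x,
        forall x y, flink V A (c x) (c y) -> c x = c y,
        forall n, closed (P n),
        forall x, exists n, P n x &
        forall n x, P n x -> c x = v n].
Proof.
move=> fV cact; have [es [esX es_sep]] := maximal_separated A fV.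
pose p x := fun e => `[< flink V A e x >].
have hasp x : has (p x) es.
  by have [e ees ex] := esX x; apply/hasP; exists e => //; apply/asboolP.
pose O i := [set x | flink V A (nth x0 es i) x].
have oO i : open (O i) by apply: flink_open => //; have [] := fV.
have /choice[C CP] : forall i, exists C : nat -> set X,
    (forall m, closed (C m)) /\ \bigcup_m C m = O i.
  by move=> i; have [C ? ?] := open_bigcup_closed (oO i); exists C.
pose P (n : nat) := if @choice.unpickle (nat * nat)%type n is Some (i, m) then
  if (i < size es)%N then C i m `&` \bigcap_(j in [set j | (j < i)%N]) ~` O j
  else set0 else set0.
pose v (n : nat) := if @choice.unpickle (nat * nat)%type n is Some (i, m) then
  nth x0 es i else x0.
pose c x := nth x0 es (find (p x) es).
exists c, P, v; split.
- by move=> x; have /asboolP := nth_find x0 (hasp x).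
- move=> x y; apply: es_sep; apply: mem_nth; rewrite -has_find; exact: hasp.
- move=> n; rewrite /P; case: choice.unpickle => [[i m]|]; last exact: closed0.
  case: ifP => _; last exact: closed0.
  have [Ccl _] := CP i; apply: closedI => //; apply: closed_bigI => j _.
  exact: open_closedC.
- move=> x; pose i := find (p x) es.
  have ies : (i < size es)%N by rewrite -has_find; exact: hasp.
  have [m _ Cx] : (\bigcup_m C i m) x.
    by have [_ ->] := CP i; have /asboolP := nth_find x0 (hasp x).
  exists (@choice.pickle (nat * nat)%type (i, m)); rewrite /P choice.pickleK ies; split => // j /= ji Ojx.
  by have := before_find x0 ji; rewrite /p asboolT.
- move=> n x; rewrite /P /v; case: choice.unpickle => [[i m]|//].
  case: ifP => // ies [Cx nO].
  rewrite /c; congr nth; apply/eqP; rewrite eqn_leq; apply/andP; split.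
    rewrite leqNgt; apply/negP => /(before_find x0); rewrite /p.
    move/asboolP; apply; suff : O i x by [].
    by have [_ <-] := CP i; exists m.
  rewrite leqNgt; apply/negP => /nO; apply.
  by have /asboolP := nth_find x0 (hasp x).
Qed.

End Centers.

(** * Levels of geometric growth *)

Section Levels.
Context (R : realType) (G : groupType) (F : nat -> {fset G}).

(** The next level is the first later index at which the cardinality exceeds [1 + d] times the
    present one. *)
Lemma geometric_levels (d : R) N : 0 < d ->
  (forall m, \forall n \near \oo, (m <= #|` F n|)%N) ->
  exists n : nat -> nat, [/\ n 0%N = N, forall k, (n k < n k.+1)%N,
    forall k, (1 + d) * #|` F (n k)|%:R < #|` F (n k.+1)|%:R &
    forall k j, (n k <= j)%N -> (j < n k.+1)%N ->
      #|` F j|%:R <= (1 + d) * #|` F (n k)|%:R].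
Proof.
move=> d0 Funb.
have /choice[next nextP] : forall m, exists m', [/\ (m < m')%N,
    (1 + d) * #|` F m|%:R < #|` F m'|%:R &
    forall j, (m <= j)%N -> (j < m')%N ->
      #|` F j|%:R <= (1 + d) * #|` F m|%:R].
  move=> m.
  have ex : exists m', (m < m')%N && ((1 + d) * #|` F m|%:R < #|` F m'|%:R).
    have [M _ HM] := Funb (Num.truncn ((1 + d) * #|` F m|%:R)).+1.
    exists (maxn m.+1 M); rewrite leq_maxl/=.
    apply: lt_le_trans (truncnS_gt _) _; rewrite ler_nat; apply: HM => /=.
    exact: leq_maxr.
  case: (ex_minnP ex) => m' /andP[mm' m'P] m'min; exists m'; split=> // j mj jm'.
  rewrite leNgt; apply/negP => h; move: mj; rewrite leq_eqVlt => /orP[/eqP mj|mj].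
    move: h; rewrite -mj ltNge => /negP; apply.
    by rewrite ler_peMl// lerDl ltW.
  by have := m'min j; rewrite mj h leqNgt jm' => /(_ isT).
exists (fun k => iter k next N); split=> // k; have [] := nextP (iter k next N) => //.
Qed.

Lemma exists_level (n : nat -> nat) j : (forall k, (n k < n k.+1)%N) ->
  (n 0 <= j)%N -> exists k, (n k <= j)%N && (j < n k.+1)%N.
Proof.
move=> nlt n0j.
have nge k : (k <= n k)%N by elim: k => // k /leq_ltn_trans; apply.
have ex : exists k, (j < n k.+1)%N by exists j; exact: leq_ltn_trans (nge j) (nlt j).
case: (ex_minnP ex) => k jk kmin; exists k; rewrite jk andbT.
case: k jk kmin => // k jk kmin; rewrite leqNgt; apply/negP => /kmin.
by rewrite ltnn.
Qed.

End Levels.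

(** * Comparison of Bowen covers with covers by itinerary cells *)

Section Itinerary.
Context (R : realType) (X : metricType R) (G : groupType) (act : G -> X -> X).
Context (F : nat -> {fset G}) (U V : set (set X)) (n : nat -> nat).
Context (c : nat -> X -> X) (d e : R).

(** The whole history of labels is kept, so that the partitions are nested. *)
Definition itinerary (k : nat) (x : X) : seq X := mkseq (fun i => c i x) k.+1.

Definition level_card (k : nat) : R := #|` F (n k)|%:R.

Definition bowen_weight (s : R) (u : set_family X G) : R :=
  expR (- s * (fam_card u)%:R).

(** The vanishing of [bowen_measure] at exponent [s], restated in terms of covers. *)
Definition bowen_null W s E : Prop := forall N,
  null (\bigcup_(j in [set j | (N <= j)%N]) families W (F j)) (fam_set act)
    (bowen_weight s) E.

Hypothesis d0 : 0 < d.
Hypothesis e0 : 0 < e.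
Hypothesis F_homo : forall i j, (i <= j)%N -> (F i `<=` F j)%fset.
Hypothesis n_lt : forall k, (n k < n k.+1)%N.
Hypothesis n_geom : forall k, (1 + d) * level_card k < level_card k.+1.
Hypothesis n_level : forall k j, (n k <= j)%N -> (j < n k.+1)%N ->
  #|` F j|%:R <= (1 + d) * level_card k.
Hypothesis V_star : forall z, exists2 A, U A &
  forall x y, link V z x -> link V x y -> A y.
Hypothesis VT : \bigcup_(B in V) B = setT.
Hypothesis c_link : forall k x, flink act V (F (n k)) (c k x) x.
Hypothesis c_sep : forall k x y,
  flink act V (F (n k)) (c k x) (c k y) -> c k x = c k y.

Definition few_words W m := forall Z, cover_join act U (F m) Z ->
  exists2 D : {fset (set X)}, covers_by (cover_join act W (F m)) Z D &
    #|` D|%:R <= expR (e * #|` F m|%:R).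

Let n_homo : {homo n : i j / (i <= j)%N}.
Proof.
move=> i j /subnK <-; elim: (j - i)%N => // m IH.
by rewrite addSn; apply: leq_trans IH (ltnW (n_lt _)).
Qed.

Let n_ge k : (k <= n k)%N.
Proof. by elim: k => // k /leq_ltn_trans; apply. Qed.

Lemma level_card_homo : {homo level_card : i j / (i <= j)%N >-> i <= j}.
Proof.
by move=> i j ij; rewrite ler_nat; apply/fsubset_leq_card/F_homo/n_homo.
Qed.

(** The points of a cell share their center of level [k], so they lie in one element of the join of
    [U]. The number of words of [W] covering it is absorbed by raising the exponent by [e]. *)
Lemma cell_covered W s t k l : few_words W (n k) -> t = s + e ->
  exists L : set (set_family X G), [/\ L `<=` families W (F (n k)),
    cell itinerary (k, l) `<=` \bigcup_(u in L) fam_set act u &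
    (\esum_(u in L) (bowen_weight t u)%:E <= (weight level_card s (k, l))%:E)%E].
Proof.
move=> fW ->.
have [C0|/set0P[x0 x0l]] := eqVneq (cell itinerary (k, l)) set0.
  by exists set0; split=> //; rewrite ?C0// esum_set0 lee_fin expR_ge0.
have /choice[p pP] : forall g, exists A, U A /\
    forall y, link V (act g (c k x0)) y -> A y.
  move=> g; have [A UA AP] := V_star (act g (c k x0)); exists A; split => // y.
  by apply: AP; exact: link_refl.
have [|D [DW ZD] Dc] := fW [set y | forall g, g \in F (n k) -> p g (act g y)].
  by apply/cover_joinP; exists p => // g _; have [] := pP g.
have /choice[w wP] : forall Y, exists u, Y \in D ->
    families W (F (n k)) u /\ fam_set act u = Y.
  move=> Y; have [YD|nYD] := boolP (Y \in D); last by exists (word fset0 (fun=> setT)).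
  by have [u Wu uY] := DW Y YD; exists u.
exists (w @` [set` D]); split.
- by move=> _ [Y YD <-]; have [] := wP Y YD.
- move=> y yl; have [|Y YD Yy] := ZD y.
    move=> g gF; have [_] := pP g; apply.
    have -> : c k x0 = c k y.
      rewrite /itinerary/cell/= in x0l yl.
      have := etrans x0l (esym yl); rewrite !mkseqS => /rcons_inj[].
      by [].
    exact: c_link.
  exists (w Y); first by exists Y.
  by have [_ ->] := wP Y YD.
- apply: le_trans (_ : ((size (map w D))%:R * expR (- (s + e) * level_card k))%:E <= _)%E.
    apply: esum_seq_le => [|_ [Y YD <-]|_ [Y YD <-]]; first exact: expR_ge0.
      by apply/mapP; exists Y.
    have [[wd _] _] := wP Y YD.
    by rewrite /bowen_weight /fam_card wd.
  rewrite size_map lee_fin.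
  apply: le_trans (_ : expR (e * level_card k) * expR (- (s + e) * level_card k) <= _).
    by apply: ler_wpM2r; [exact: expR_ge0|exact: Dc].
  by rewrite -expRD -mulrDl opprD addrCA subrr addr0.
Qed.

Lemma bowen_null_of_nnull W s E : 0 <= s ->
  (\forall m \near \oo, few_words W m) ->
  nnull itinerary level_card s E -> bowen_null W (s + e) E.
Proof.
move=> s0 [N0 _ HN0] nE N eta eta0.
pose N1 := maxn N N0.
pose w1 := expR (- s * level_card N1).
have w1_gt0 : 0 < w1 by exact: expR_gt0.
(* A total weight below that of a cell of level [N1] forces all cells to levels at least [N1], where
   [few_words] holds and the families come late enough. *)
have [|B [_ EB Bc]] := nE (Num.min eta (w1 / 2)).
  by rewrite lt_min eta0 divr_gt0.
have Bdeep b : B b -> (N1 <= b.1)%N.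
  move=> Bb; rewrite leqNgt; apply/negP => bN1.
  have : (\esum_(j in [set b]) (weight level_card s j)%:E <= (w1 / 2)%:E)%E.
    apply: le_trans (_ : _ <= \esum_(j in B) (weight level_card s j)%:E)%E _.
      by apply: esum_le_subset => _ ->.
    by apply: le_trans Bc _; rewrite lee_fin ge_min lexx orbT.
  rewrite esum_set1 ?lee_fin ?expR_ge0//.
  have : w1 <= weight level_card s b.
    rewrite ler_expR !mulNr lerN2; apply: ler_wpM2l => //.
    exact/level_card_homo/ltnW.
  lra.
have /choice[L LP] : forall b : nat * seq X, exists L : set (set_family X G), B b ->
    [/\ L `<=` families W (F (n b.1)),
      cell itinerary b `<=` \bigcup_(u in L) fam_set act u &
      (\esum_(u in L) (bowen_weight (s + e) u)%:E <= (weight level_card s b)%:E)%E].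
  move=> [k l]; have [Bb|nBb] := pselect (B (k, l)); last by exists set0.
  have [|L LP] := @cell_covered W s (s + e) k l _ erefl; last by exists L.
  apply: HN0 => /=; apply: leq_trans (leq_trans _ (Bdeep _ Bb)) (n_ge k).
  exact: leq_maxr.
exists (\bigcup_(b in B) L b); split.
- move=> u [b Bb Lu]; have [Lb _ _] := LP b Bb; exists (n b.1); last exact: Lb.
  apply: leq_trans (leq_trans _ (Bdeep _ Bb)) (n_ge b.1); exact: leq_maxl.
- move=> x Ex; have [b Bb xb] := EB x Ex.
  by have [_ /(_ x xb)[u Lu xu] _] := LP b Bb; exists u => //; exists b.
- apply: (@le_trans _ _ (\esum_(b in B) (weight level_card s b)%:E)%E).
    apply: esum_bigcup_le => [u|b Bb]; first by rewrite lee_fin expR_ge0.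
    by have [] := LP b Bb.
  by apply: le_trans Bc _; rewrite lee_fin ge_min lexx.
Qed.

(* All the centers of [D] lie in one element of the join of [U], and an element of
   the join of [V] contains at most one of them. *)
Lemma centers_few k (D : set X) : few_words V (n k) ->
  (forall x y, D x -> D y -> flink act V (F (n k)) x y) ->
  exists r : seq X, (forall x, D x -> c k x \in r) /\
    (size r)%:R <= expR (e * level_card k).
Proof.
move=> fV Dl; have [D0|/set0P[x0 Dx0]] := eqVneq D set0.
  by exists [::]; split; [move=> x; rewrite D0|rewrite expR_ge0].
have /choice[p pP] : forall g, exists A, U A /\
    forall x y, link V (act g x0) x -> link V x y -> A y.
  by move=> g; have [A UA AP] := V_star (act g x0); exists A.
have [|W [WV ZW] Wc] := fV [set y | forall g, g \in F (n k) -> p g (act g y)].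
  by apply/cover_joinP; exists p => // g _; have [] := pP g.
pose z Y := xget x0 ([set c k x | x in D] `&` Y).
exists (map z W); split; last by rewrite size_map.
move=> x Dx.
have [|Y YW Yx] := ZW (c k x).
  move=> g gF; have [_] := pP g; apply; first exact: (Dl _ _ Dx0 Dx).
  by apply: link_sym; exact: c_link.
apply/mapP; exists Y => //; rewrite /z; case: xgetP => [y _ [[y' Dy' <-] Yy]|].
  apply: c_sep; exact: cover_join_flink (WV _ YW) Yx Yy.
by move=> /(_ (c k x)) h; exfalso; apply: h; split => //; exists x.
Qed.

(* The geometric growth of the levels bounds the sum of the errors made up to
   level [k] by a multiple of the last one. *)
Lemma itinerary_few k (D : set X) : (forall i, few_words V (n i)) ->
  (forall x y, D x -> D y -> flink act V (F (n k)) x y) ->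
  exists r : seq (seq X), (forall x, D x -> itinerary k x \in r) /\
    (size r)%:R <= expR (e * ((1 + d) / d * level_card k)).
Proof.
move=> fV.
elim: k => [|k IH] Dl.
  have [r [rP rs]] := centers_few (fV 0%N) Dl.
  exists [seq [:: x] | x <- r]; split; first by move=> x Dx; apply/mapP; exists (c 0 x); rewrite // rP.
  rewrite size_map; apply: le_trans rs _; rewrite ler_expR ler_pM2l//.
  by rewrite ler_peMl// ?ler_pdivlMr// ?mul1r ?lerDr.
have [|r1 [r1P r1s]] := IH.
  move=> x y Dx Dy g gF; apply: Dl => //.
  by apply: (fsubsetP (F_homo _)) gF; exact: n_homo.
have [r [rP rs]] := centers_few (fV k.+1) Dl.
exists [seq rcons l z | l <- r1, z <- r]; split.
  move=> x Dx; apply/allpairsP; exists (itinerary k x, c k.+1 x) => /=.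
  by split; [exact: r1P|exact: rP|rewrite /itinerary mkseqS].
rewrite size_allpairs natrM; apply: le_trans (ler_pM _ _ r1s rs) _ => //.
rewrite -expRD ler_expR -mulrDr ler_pM2l//.
have : (1 + d) / d * level_card k <= level_card k.+1 / d.
  by rewrite mulrAC ler_pM2r ?invr_gt0// ltW.
have -> : (1 + d) / d * level_card k.+1 = level_card k.+1 / d + level_card k.+1.
  by rewrite [(1 + d) / d]mulrDl mul1r divff ?gt_eqF// mulrDl mul1r [_^-1 * _]mulrC.
lra.
Qed.

(** A family over [F j] with [j] between levels [k] and [k + 1] is replaced by the cells of level
    [k] that it meets. The factor [1 + d] on [s] pays for the gap between levels, the other term for
    the number of these cells. *)
Lemma nnull_of_bowen_null s E : 0 <= s -> (forall i, few_words V (n i)) ->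
  bowen_null V s E ->
  nnull itinerary level_card (s * (1 + d) + e * ((1 + d) / d)) E.
Proof.
move=> s0 fV bE eta eta0; have [L [LF EL Lc]] := bE (n 0%N) eta eta0.
pose s' := s * (1 + d) + e * ((1 + d) / d).
have /choice[B BP] : forall u, exists B : set (nat * seq X), L u ->
    fam_set act u `<=` \bigcup_(b in B) cell itinerary b /\
    (\esum_(b in B) (weight level_card s' b)%:E <= (bowen_weight s u)%:E)%E.
  move=> u; have [Lu|nLu] := pselect (L u); last by exists set0.
  have [j /= nj uj] := LF u Lu.
  have [k /andP[kj jk]] := exists_level n_lt nj.
  have [|r [rP rs]] := @itinerary_few k (fam_set act u) fV.
    move=> x y ux uy g gF; apply: (cover_join_flink (A := F j) (Z := fam_set act u)) => //.
      by exists u.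
    exact: (fsubsetP (F_homo kj)).
  exists [set (k, itinerary k x) | x in fam_set act u] => _; split.
    by move=> x ux; exists (k, itinerary k x) => //; exists x.
  apply: le_trans (_ : ((size (map (pair k) r))%:R * expR (- s' * level_card k))%:E <= _)%E.
    apply: esum_seq_le => [|_ [x ux <-]|_ [x ux <-]]; first exact: expR_ge0.
      by apply/mapP; exists (itinerary k x) => //; exact: rP.
    exact: lexx.
  rewrite size_map lee_fin; apply: le_trans (ler_wpM2r (expR_ge0 _) rs) _.
  have -> : bowen_weight s u = expR (- s * #|` F j|%:R).
    by have [uF _] := uj; rewrite /bowen_weight /fam_card uF.
  rewrite -expRD ler_expR /s'.
  have := ler_wpM2l s0 (n_level kj jk).
  move: (level_card k) (#|` F j|%:R) => a b.
  move: ((1 + d) / d) => q; lra.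
exists (\bigcup_(u in L) B u); split=> //.
- move=> x /EL[u Lu ux]; have [/(_ x ux)[b Bb xb] _] := BP u Lu.
  by exists b => //; exists u.
- apply: le_trans Lc; apply: esum_bigcup_le => [b|u Lu].
    by rewrite lee_fin expR_ge0.
  by have [] := BP u Lu.
Qed.

End Itinerary.

(** * Bowen entropy *)

Section BowenDimension.
Context (R : realType) (X : metricType R) (G : groupType) (act : G -> X -> X).
Context (F : nat -> {fset G}).
Implicit Types (U V : set (set X)) (K E : set X).

Lemma bowen_weight_ge0 (s : R) (u : set_family X G) : 0 <= bowen_weight s u.
Proof. exact: expR_ge0. Qed.

Lemma bowen_premeasure_ge0 K U N s : (0 <= bowen_premeasure act K U N s F)%E.
Proof.
apply: le_ereal_inf_tmp => _ [L _ <-].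
by apply: esum_ge0 => u _; rewrite lee_fin expR_ge0.
Qed.

Lemma bowen_measureE K U s :
  bowen_measure act K U s F =
  ereal_sup (range (fun N => bowen_premeasure act K U N s F)).
Proof.
apply/cvg_lim => //; apply: ereal_nondecreasing_cvgn => m n mn.
apply: le_ereal_inf => _ [L [LF KL] <-]; exists L => //; split=> //.
by move=> u /LF[j /= nj uj]; exists j => //=; exact: leq_trans nj.
Qed.

Lemma bowen_measure0P K U s :
  bowen_measure act K U s F = 0%E <-> bowen_null act F U s K.
Proof.
rewrite bowen_measureE; split=> [H N c c0|H].
  have : (bowen_premeasure act K U N s F < c%:E)%E.
    apply: (@le_lt_trans _ _ 0%E); last by rewrite lte_fin.
    by rewrite -H; apply: ereal_sup_ubound; exists N.
  by move=> /ereal_inf_lt[_ [L [LF KL] <-] /ltW Lc]; exists L.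
apply/le_anti/andP; split.
  apply: ge_ereal_sup => _ [N _ <-]; apply/lee_addgt0Pr => c c0.
  have [L [LF KL Lc]] := H N c c0; rewrite add0e; apply: le_trans Lc.
  by apply: ereal_inf_lbound; exists L.
apply: (@le_trans _ _ (bowen_premeasure act K U 0 s F)).
  exact: bowen_premeasure_ge0.
by apply: ereal_sup_ubound; exists 0%N.
Qed.

Lemma bowen_null_exponent U s s' K : s <= s' ->
  bowen_null act F U s K -> bowen_null act F U s' K.
Proof.
move=> ss' H N c c0; have [L [LF KL Lc]] := H N c c0; exists L; split=> //.
apply: le_trans Lc; apply: le_esum => u _.
by rewrite lee_fin ler_expR !mulNr lerN2 ler_wpM2r.
Qed.

Lemma bowen_htop_cover_le K U s : 0 <= s -> bowen_null act F U s K ->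
  (bowen_htop_cover act K U F <= s%:E)%E.
Proof.
move=> s0 /bowen_measure0P nK; apply: ereal_inf_lbound.
by exists s.
Qed.

Lemma bowen_null_of_lt K U s : (bowen_htop_cover act K U F < s%:E)%E ->
  bowen_null act F U s K.
Proof.
move=> /ereal_inf_lt[_ [s' [_ /bowen_measure0P H] <-]].
by rewrite lte_fin => /ltW ss; exact: bowen_null_exponent H.
Qed.

Lemma bowen_htop_cover_ge0 K U : (0 <= bowen_htop_cover act K U F)%E.
Proof. by apply: le_ereal_inf_tmp => _ [s [s0 _] <-]; rewrite lee_fin. Qed.

Lemma bowen_htop_leP K t : 0 <= t ->
  (bowen_htop act K F <= t%:E)%E <->
  (forall U, finite_open_cover U -> forall s, t < s -> bowen_null act F U s K).
Proof.
move=> t0; split=> [H U fU s ts|H].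
  apply: bowen_null_of_lt; apply: (@le_lt_trans _ _ t%:E); last by rewrite lte_fin.
  by apply: le_trans H; apply: ereal_sup_ubound; exists U.
apply: ge_ereal_sup => _ [U fU <-]; apply/lee_addgt0Pr => c c0.
rewrite -EFinD; apply: bowen_htop_cover_le; first by rewrite addr_ge0// ltW.
by apply: H => //; rewrite ltrDl.
Qed.

Lemma le_bowen_htop K K' : K `<=` K' -> (bowen_htop act K F <= bowen_htop act K' F)%E.
Proof.
move=> KK'; apply: ge_ereal_sup => _ [U fU <-].
apply: (@le_trans _ _ (bowen_htop_cover act K' U F)); last first.
  by apply: ereal_sup_ubound; exists U.
apply: le_ereal_inf => _ [s [s0 /bowen_measure0P H] <-]; exists s => //; split=> //.
by apply/bowen_measure0P => N; apply: sub_null (H N).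
Qed.

Lemma bowen_htop_bigcup_le (E : nat -> set X) t : 0 <= t ->
  (forall m, (bowen_htop act (E m) F <= t%:E)%E) ->
  (bowen_htop act (\bigcup_m E m) F <= t%:E)%E.
Proof.
move=> t0 H; apply/bowen_htop_leP => // U fU s ts N.
apply: null_bigcup => [u|m]; first exact: bowen_weight_ge0.
by move/(bowen_htop_leP _ t0) : (H m) => /(_ U fU s ts N).
Qed.

Lemma bowen_htop_set0 : bowen_htop act set0 F = 0%E.
Proof.
apply/le_anti/andP; split.
  apply/bowen_htop_leP => // U fU s _ N c c0; exists set0; split=> //.
  by rewrite esum_set0 lee_fin ltW.
have fT : finite_open_cover [set [set: X]].
  split; [exact: finite_set1|by move=> _ ->; exact: openT|].
  by rewrite bigcup_set1.
apply: le_trans (bowen_htop_cover_ge0 set0 [set setT]) _.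
by apply: ereal_sup_ubound; exists [set setT].
Qed.

End BowenDimension.

(** * Coding a Souslin set together with its labels *)

Lemma baire_even_continuous :
  continuous (fun s : baire => (fun i => s i.*2) : baire).
Proof.
move=> s; apply/cvg_sup => i U [_ [[W oW <-] Ws WU]].
apply: filterS WU _; apply: (@baire_proj_continuous i.*2 s).
by apply: open_nbhs_nbhs.
Qed.

Lemma baire_mkseq_open (T : Type) (v : nat -> nat -> T) k (l : seq T) :
  open ([set s | mkseq (fun i => v i (s i.*2.+1)) k = l] : set baire).
Proof.
rewrite openE => s sl.
have : \forall s' \near s, forall i, i \in iota 0 k -> s' i.*2.+1 = s i.*2.+1.
  apply: (near_all_seq (Phi := nbhs s) (r := iota 0 k)
    (P := fun i s' => s' i.*2.+1 = s i.*2.+1)) => i _.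
  apply: (@baire_proj_continuous i.*2.+1 s [set m | m = s i.*2.+1]).
  exact: discrete_set1.
apply: filterS => s' H /=; rewrite -sl /mkseq.
by apply/eq_in_map => i /H ->.
Qed.

(** For each [m], either the coordinate [s k.*2.+1] differs from [m], a closed condition as [nat] is
    discrete, or the coded point lies in the closed set [P k m]. *)
Lemma souslin_pieces_closed (X : topologicalType) (f : baire -> X)
    (P : nat -> nat -> set X) : continuous f -> (forall k m, closed (P k m)) ->
  closed ([set s | forall k, P k (s k.*2.+1) (f (fun i => s i.*2))] : set baire).
Proof.
move=> cf Pcl.
have -> : [set s : baire | forall k, P k (s k.*2.+1) (f (fun i => s i.*2))] =
  \bigcap_k \bigcap_m ((fun s : baire => s k.*2.+1) @^-1` (~` [set m]) `|`
    (fun s : baire => f (fun i => s i.*2)) @^-1` P k m).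
  apply/seteqP; split=> s /= H.
    move=> k _ m _; have [<-|sm] := eqVneq (s k.*2.+1) m; first by right; exact: H.
    by left; apply/eqP.
  by move=> k; have [/(_ erefl)|] := H k I (s k.*2.+1) I.
apply: closed_bigI => k _; apply: closed_bigI => m _; apply: closedU.
  apply: closed_comp; last exact: discrete_closed.
  by move=> s _; exact: baire_proj_continuous.
apply: closed_comp; last exact: Pcl.
move=> s _; apply: (@continuous_comp baire baire X (fun s => (fun i => s i.*2)) f).
  exact: baire_even_continuous.
exact: cf.
Qed.

Lemma exists_subset_entropy (R : realType) (X : metricType R) (G : groupType)
    (act : G -> X -> X) (F : nat -> {fset G}) (f : baire -> X) (h d : R) :
  Gsystem act -> folner_seq R F -> (forall n, (F n `<=` F n.+1)%fset) ->
  asymptotically_h_expansive act F -> continuous f ->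
  (h%:E < bowen_htop act (range f) F)%E -> 0 < d -> d <= 1 -> d < h ->
  exists2 E, E `<=` range f & (bowen_htop act E F <= h%:E)%E /\
    ((h - (h + 2) * d)%:E <= bowen_htop act E F)%E.
Proof.
move=> sys hF F_mono hexp cf hK d0 d1 dh.
pose x0 := f (fun=> 0%N).
have F_homo i j : (i <= j)%N -> (F i `<=` F j)%fset.
  move=> /subnK <-; elim: (j - i)%N => // m IH.
  by rewrite addSn; exact: fsubset_trans IH (F_mono _).
(* The comparison of exponents involves the error $e(1+d)/d$, which becomes $d(1+d)$ and is small
   with [d]. *)
pose e := d ^+ 2.
have e0 : 0 < e by rewrite exprn_gt0.
have [_ [U fU <-] Ulow] : exists2 y, [set ereal_sup [set htop_cond act F W U |
    W in @finite_open_cover X] | U in @finite_open_cover X] y & (y < e%:E)%E.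
  by apply: ereal_inf_lt; rewrite -/(tail_entropy act F) hexp lte_fin.
have few W : finite_open_cover W -> \forall m \near \oo, few_words act F U e W m.
  move=> fW; have [_ _ UT] := fU; have [finW _ WT] := fW.
  apply: (htop_cond_lt x0 (gsys_actM sys) UT finW WT hF).
  by apply: le_lt_trans Ulow; apply: ereal_sup_ubound; exists W.
have [V fV V_star] := star_refinement (gsys_compact sys) fU.
have VT : \bigcup_(B in V) B = setT by have [] := fV.
have [N0 _ fewV] := few V fV.
have Funb := folner_card_unbounded hF (gsys_infinite sys).
have [n [n0 n_lt n_geom n_level]] := @geometric_levels R G F d N0 d0 Funb.
have n_homo k : (N0 <= n k)%N.
  elim: k => [|k IH]; first by rewrite n0.
  exact: leq_trans IH (ltnW (n_lt k)).
have fewVn i : few_words act F U e V (n i) by apply: fewV; exact: n_homo.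
have /choice[c cP] : forall k, exists c : X -> X, exists P : nat -> set X,
    exists v : nat -> X,
    [/\ forall x, flink act V (F (n k)) (c x) x,
        forall x y, flink act V (F (n k)) (c x) (c y) -> c x = c y,
        forall n, closed (P n),
        forall x, exists n, P n x &
        forall n x, P n x -> c x = v n].
  by move=> k; apply: center_system => //; exact: gsys_continuous sys.
have /choice[P /choice[v pieces]] := cP.
have c_link k x : flink act V (F (n k)) (c k x) x by have [] := pieces k.
have c_sep k x y : flink act V (F (n k)) (c k x) (c k y) -> c k x = c k y.
  by have [_ + _ _ _] := pieces k; apply.
pose a := level_card R F n.
have a_ge0 k : 0 <= a k by [].
have a_homo : {homo a : i j / (i <= j)%N >-> i <= j} by exact: level_card_homo.
have a_unb C : exists k, C < a k.
  have [M _ HM] := Funb (Num.truncn C).+1; exists M.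
  apply: lt_le_trans (truncnS_gt _) _; rewrite ler_nat; apply: HM => /=.
  by elim: (M) => // k /leq_ltn_trans; apply.
pose ev (s : baire) : baire := fun i => s i.*2.
(* The even coordinates of [s] code a point of the Souslin set, the odd ones
   closed sets on which its labels are constant. *)
pose S : set baire := [set s | forall k, P k (s k.*2.+1) (f (ev s))].
pose q k (s : baire) := mkseq (fun i => v i (s i.*2.+1)) k.+1.
have Scl : closed S.
  by apply: (souslin_pieces_closed (P := P) cf) => k m; have [] := pieces k.
have qE k s : S s -> q k s = itinerary c k (f (ev s)).
  move=> Ss; apply/eq_in_map => i _.
  by have [_ _ _ _ H] := pieces i; rewrite (H _ _ (Ss i)).
have q_refine k s s' : q k.+1 s = q k.+1 s' -> q k s = q k s'.
  by rewrite /q !(mkseqS _ k.+1) => /rcons_inj/(congr1 fst).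
have q_open k l : open [set s | q k s = l] by exact: baire_mkseq_open.
have null_image s (C : set baire) : C `<=` S ->
    nnull q a s C <-> nnull (itinerary c) a s [set f (ev y) | y in C].
  move=> CS; split=> H eta /H[B [_ CB Bc]]; exists B; split=> //.
    move=> _ [y Cy <-]; have [[k l] Bb /= yl] := CB y Cy.
    by exists (k, l) => //; rewrite /cell/= -qE//; exact: CS.
  move=> y Cy; have [|[k l] Bb yl] := CB (f (ev y)); first by exists y.
  by exists (k, l) => //; rewrite /cell/= qE//; exact: CS.
have S_onto : [set f (ev y) | y in S] = range f.
  apply/seteqP; split=> [_ [y _ <-]|_ [y _ <-]]; first by exists (ev y).
  have /choice[m mP] : forall k, exists m, P k m (f y).
    by move=> k; have [_ _ _ + _] := pieces k; apply.
  pose s : baire := fun i => if odd i then m i./2 else y i./2.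
  have sy : ev s = y.
    by apply/funext => i; rewrite /ev /s odd_double doubleK.
  exists s; last by rewrite sy.
  by move=> k; rewrite sy /s /= odd_double uphalf_double; exact: mP.
(* Passing from cells to Bowen covers raises the exponent by [e], so dimension at most [t] gives
   entropy at most [h]. *)
pose t := h - e.
have t0 : 0 < t by rewrite subr_gt0; apply: le_lt_trans dh; rewrite /e expr2 ler_piMl// ltW.
have upper E : (forall s, t < s -> nnull (itinerary c) a s E) ->
    (bowen_htop act E F <= h%:E)%E.
  move=> H; apply/bowen_htop_leP; first by apply: ltW; apply: lt_trans dh.
  move=> W fW s hs; have -> : s = (s - e) + e by rewrite subrK.
  have ts : t < s - e by rewrite /t ltrD2r.
  apply: (bowen_null_of_nnull F_homo n_lt V_star VT c_link).
  - by apply: ltW; exact: lt_trans ts.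
  - exact: few.
  - exact: H.
(* Were [S] null at every exponent above [t], the entropy of the whole Souslin set would be at most
   [h]. *)
have [t' tt' nS] : exists2 t', t < t' & ~ nnull q a t' S.
  apply: contrapT => /forall2NP H; move: hK; rewrite ltNge => /negP; apply.
  apply: upper => s ts; rewrite -S_onto; apply/null_image => //.
  by have [|/contrapT] := H s.
have [C [CS Cupper Clower]] := net_subset q_refine q_open a_ge0 a_homo a_unb Scl t0 tt' nS.
exists [set f (ev y) | y in C].
  by move=> _ [y _ <-]; exists (ev y).
split; first by apply: upper => s ts; apply/null_image => //; exact: Cupper.
rewrite leNgt; apply/negP => low.
(* The solution of $s(1+d) + e(1+d)/d = t$: being Bowen null at [s] would make [C] null at [t]. *)
pose s := t / (1 + d) - d.
have hs : h - (h + 2) * d <= s.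
  rewrite /s lerBrDr ler_pdivlMr ?addr_gt0// /t /e.
  have : 0 <= h * d ^+ 2 by rewrite mulr_ge0 ?sqr_ge0// ltW// (lt_trans d0).
  nra.
have lowV : (bowen_htop_cover act [set f (ev y) | y in C] V F < s%:E)%E.
  apply: (@le_lt_trans _ _ (bowen_htop act [set f (ev y) | y in C] F)).
    by apply: ereal_sup_ubound; exists V.
  by apply: lt_le_trans low _; rewrite lee_fin.
have s0 : 0 <= s.
  rewrite -lee_fin; apply: ltW; apply: le_lt_trans lowV.
  exact: bowen_htop_cover_ge0.
apply: Clower; apply/null_image => //.
have := nnull_of_bowen_null d0 e0 F_homo n_lt n_geom n_level V_star c_link c_sep s0
  fewVn (bowen_null_of_lt lowV).
suff -> : s * (1 + d) + e * ((1 + d) / d) = t by [].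
have dn0 : 1 + d != 0 by rewrite gt_eqF// addr_gt0.
by rewrite /s mulrBl divfK// /e expr2 [(1 + d) / d]mulrC mulrA mulfK ?gt_eqF// subrK.
Qed.

Theorem theorem1p2 (R : realType) (X : metricType R) (G : groupType)
    (act : G -> X -> X) (F : nat -> {fset G})
    (hsys : Gsystem act)
    (hfin : (htop act F < +oo)%E)
    (hF : folner_seq R F)
    (hF1 : (1%g \in F 0%N)%fset)
    (hFmono : forall n : nat, (F n `<=` F n.+1)%fset)
    (hexp : asymptotically_h_expansive act F) :
  D_hereditarily_lowerable act F.
Proof.
move=> K K0 sK h h0 hK.
have [hE|hlt] := eqVneq h (bowen_htop act K F); first by exists K; split.
have {hlt}hK : (h < bowen_htop act K F)%E by rewrite lt_neqAle hlt.
case: h h0 hK => [h| |//] h0 hK; last by move: hK; rewrite ltNge leey.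
move: h0; rewrite lee_fin le_eqVlt => /orP[/eqP <-|h0].
  (* Entropy zero is realized by the empty set. *)
  by exists set0; rewrite bowen_htop_set0; split.
case: sK => [K_eq0|[f [cf fK]]]; first by case: K0 => x; rewrite K_eq0.
rewrite -fK in hK *.
(* Positive, at most 1, less than [h] and tending to zero, so that the lower bounds for the
   entropies of the [E m] tend to [h]. *)
pose d m : R := Num.min 1 (h / 2) / m.+1%:R.
have min0 : 0 < Num.min 1 (h / 2) by rewrite lt_min ltr01 divr_gt0.
have dle m : d m <= Num.min 1 (h / 2).
  by rewrite ler_pdivrMr ?ltr0n// ler_peMr ?ler1n// ltW.
have /choice[E EP] : forall m, exists E, [/\ E `<=` range f,
    (bowen_htop act E F <= h%:E)%E &
    ((h - (h + 2) * d m)%:E <= bowen_htop act E F)%E].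
  move=> m; have [|||E Ef [Eup Elow]] := exists_subset_entropy (d := d m)
    hsys hF hFmono hexp cf hK; last by exists E.
  - by rewrite divr_gt0.
  - by apply: le_trans (dle m) _; rewrite ge_min lexx.
  - apply: le_lt_trans (dle m) _; apply: (@le_lt_trans _ _ (h / 2)).
      by rewrite ge_min lexx orbT.
    by rewrite ltr_pdivrMr// ltr_pMr// ltr1n.
exists (\bigcup_m E m); split.
  by move=> x [m _ Ex]; have [+ _ _] := EP m; apply.
apply/le_anti/andP; split.
  by apply: bowen_htop_bigcup_le => [|m]; [exact: ltW|have [] := EP m].
apply/lee_subgt0Pr => eta eta0.
have [m mP] : exists m : nat, (h + 2) * d m <= eta.
  pose c := (h + 2) * Num.min 1 (h / 2).
  exists (Num.truncn (c / eta)).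
  rewrite mulrA ler_pdivrMr ?ltr0n// -ler_pdivrMl//.
  by rewrite mulrC ltW// truncnS_gt.
have [_ _ low] := EP m.
apply: le_trans (le_trans low (le_bowen_htop _ _ _)).
  by rewrite -EFinB lee_fin lerD2l lerN2.
by move=> x Ex; exists m.
Qed.
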